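(* For every $\alpha\geq1$ and $\epsilon\in(0,1]$ there exist $\Delta_0\geq2\alpha$ and $c>0$ depending only on $\alpha$ and $\epsilon$ such that the following holds. Let $G=(V,E)$ be a finite simple $n$-vertex graph with maximum degree $\Delta\geq\Delta_0$ and girth at least $5$, let $q\geq2$ be an integer, let $A\in[0,1]^{q\times q}$ be symmetric and $\boldsymbol\lambda\in\mathbb R_{\geq0}^q$, and assume that at least one configuration in $[q]^V$ has positive weight, so that the Gibbs distribution $\mu_G$ with interaction matrix $A$ and external field $\boldsymbol\lambda$ on $G$ is defined. If $\mu_G$ has local $(\alpha,\epsilon)$-spectral contraction and the Glauber dynamics on $\mu_G$ is irreducible, then the Glauber dynamics on $\mu_G$ has spectral gap at least $c/n$.
   Context: The girth of a graph is the length of its shortest cycle ($\infty$ for a forest); $N(v)$ is the neighborhood of $v$ and $N[v]=N(v)\cup\{v\}$. For a graph $H$ (here $H=G$ or $H=G-v$), the Gibbs distribution with interaction matrix $A$ and external field $\boldsymbol\lambda$ is $\mu_H(\sigma)\propto\prod_{uv\in E(H)}A_{\sigma_u,\sigma_v}\prod_{v\in V(H)}\lambda_{\sigma_v}$ for $\sigma\in[q]^{V(H)}$. A pinning $\tau\in[q]^{V\setminus N[v]}$ is feasible if it has positive probability under $\mu_G$. For feasible $\tau$, $\mu^\tau_{G,v}$ is the marginal law of the spin at $v$ under $\mu_G$ conditioned on agreeing with $\tau$ on $V\setminus N[v]$, and, for $i\in N(v)$, $\mu^\tau_{G-v,i}$ is the marginal law of the spin at $i$ under $\mu_{G-v}$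 conditioned on agreeing with $\tau$ on $V\setminus N[v]$; both are viewed as vectors in $\mathbb R^q$. Local $(\alpha,\epsilon)$-spectral contraction (for $\alpha\ge1$, $\epsilon\in(0,1]$): with $B:=\mathbf 1\mathbf 1^\top-A$, for every $v\in V$ and every feasible pinning $\tau\in[q]^{V\setminus N[v]}$, (1) $\|B\mu^\tau_{G,v}\|_\infty\leq\alpha/\Delta$ and $\|B\mu^\tau_{G-v,i}\|_\infty\leq\alpha/\Delta$ for all $i\in N(v)$; (2) $\left\|\mathrm{diag}\left(\sum_{i\in N(v)}\mu^\tau_{G-v,i}\right)^{1/2}B\,\mathrm{diag}(\mu^\tau_{G,v})^{1/2}\right\|_2^2\leq\frac{1-\epsilon}{\Delta}$, where $\|\cdot\|_2$ is the operator norm induced by the Euclidean norm on $\mathbb R^q$. The (discrete-time, heat-bath) Glauber dynamics on $\mu_G$ is the Markov chain on the support $\Omega$ of $\mu_G$ which in each step chooses a vertex uniformly at random and resamples its spin from its conditional distribution under $\mu_G$ given all other spins. With transition operator $P$, it has spectral gap at least $\gamma$ if $\gamma\langle f,f\rangle_{\mu_G}\leq\langle f,(\mathrm{Id}-P)f\rangle_{\mu_G}$ for all $f:\Omega\to\mathbb R$ with $\mathbb E_{\mu_G}f=0$, where $\langle f,g\rangle_{\mu_G}=\sum_{x}\mu_G(x)f(x)g(x)$. *)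

(* Defs.v *)
From HB Require Import structures.
From mathcomp Require Import all_boot all_order all_algebra.
From mathcomp Require Import all_classical all_reals all_analysis.

Set Implicit Arguments.
Unset Strict Implicit.
Unset Printing Implicit Defensive.

Import Order.TTheory GRing.Theory Num.Theory.
Import numFieldNormedType.Exports.

Local Open Scope ring_scope.

Definition simple_graph (V : finType) (E : rel V) : Prop :=
  symmetric E /\ irreflexive E.

Definition nbhd (V : finType) (E : rel V) (v : V) : {set V} :=
  [set u | E v u]%SET.

Definition cnbhd (V : finType) (E : rel V) (v : V) : {set V} :=
  (v |: nbhd E v)%SET.

Definition max_degree (V : finType) (E : rel V) : nat :=
  (\max_(v : V) #|nbhd E v|)%N.

(* [size c > 2] excludes the sequence [:: u; v], which is an [E]-cycle in the
   sense of [path] as soon as uv is an edge. *)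
Definition graph_cycle (V : finType) (E : rel V) (c : seq V) : Prop :=
  ucycle E c /\ (2 < size c)%N.

(* The infimum of the empty set is [+oo], so forests have infinite girth. *)
Definition girth (R : realType) (V : finType) (E : rel V) : \bar R :=
  ereal_inf [set ((size c)%:R : R)%:E | c in [set c | graph_cycle E c]]%classic.

Definition del_vertex (V : finType) (E : rel V) (v : V) :
    rel {u : V | u != v} :=
  fun x y => E (val x) (val y).

Definition config (V : finType) (q : nat) : finType := {ffun V -> 'I_q}.

(* Each edge is counted once, oriented along the enumeration of [V]; the
   orientation is irrelevant when [A] is symmetric. *)
Definition weight (R : realType) (q : nat) (A : 'M[R]_q) (lam : 'cV[R]_q)
    (V : finType) (E : rel V) (sigma : config V q) : R :=
  (\prod_(p : V * V | E p.1 p.2 && (enum_rank p.1 < enum_rank p.2)%N)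
      A (sigma p.1) (sigma p.2)) *
  \prod_(v : V) lam (sigma v) 0.

Definition gibbs (R : realType) (q : nat) (A : 'M[R]_q) (lam : 'cV[R]_q)
    (V : finType) (E : rel V) (sigma : config V q) : R :=
  weight A lam E sigma / \sum_(rho : config V q) weight A lam E rho.

Definition prob (R : realType) (S : finType) (mu : S -> R) (X : pred S) : R :=
  \sum_(s : S | X s) mu s.

Definition cprob (R : realType) (S : finType) (mu : S -> R) (X Y : pred S) : R :=
  prob mu [pred s | X s && Y s] / prob mu Y.

Definition pinning (V : finType) (E : rel V) (v : V) (q : nat) : Type :=
  {ffun {u : V | u \notin cnbhd E v} -> 'I_q}.

(* [W] is the vertex set of G or of G - v, and [j] its inclusion into [V]. *)
Definition agrees (V : finType) (E : rel V) (v : V) (q : nat)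
    (W : finType) (j : W -> V) (tau : pinning E v q) : pred (config W q) :=
  fun sigma => [forall w, forall u, (j w == val u) ==> (sigma w == tau u)].

Definition feasible (R : realType) (q : nat) (A : 'M[R]_q) (lam : 'cV[R]_q)
    (V : finType) (E : rel V) (v : V) (tau : pinning E v q) : Prop :=
  0 < prob (gibbs A lam E) (agrees id tau).

Definition marginal (R : realType) (q : nat) (A : 'M[R]_q) (lam : 'cV[R]_q)
    (V : finType) (E : rel V) (v : V) (tau : pinning E v q) : 'cV[R]_q :=
  \col_(s < q) cprob (gibbs A lam E)
                 [pred sigma : config V q | sigma v == s] (agrees id tau).

Definition marginal_del (R : realType) (q : nat) (A : 'M[R]_q)
    (lam : 'cV[R]_q) (V : finType) (E : rel V) (v : V) (tau : pinning E v q)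
    (i : {u : V | u != v}) : 'cV[R]_q :=
  \col_(s < q) cprob (gibbs A lam (del_vertex E (v := v)))
                 [pred sigma : config {u : V | u != v} q | sigma i == s]
                 (agrees val tau).

Definition euclid_norm (R : realType) (q : nat) (x : 'cV[R]_q) : R :=
  Num.sqrt (\sum_(s < q) x s 0 ^+ 2).

Definition op_norm (R : realType) (q : nat) (M : 'M[R]_q) : R :=
  sup [set euclid_norm (M *m x) | x in [set x | euclid_norm x <= 1]]%classic.

(* diag(x)^(1/2), for a vector [x] with nonnegative entries *)
Definition diag_sqrt (R : realType) (q : nat) (x : 'cV[R]_q) : 'M[R]_q :=
  diag_mx (\row_(s < q) Num.sqrt (x s 0)).

(* The norm [`|_|] of a column vector is the sup norm. *)
Definition local_spectral_contraction (R : realType) (alpha eps : R) (q : nat)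
    (A : 'M[R]_q) (lam : 'cV[R]_q) (V : finType) (E : rel V) : Prop :=
  let Delta : R := (max_degree E)%:R in
  let B : 'M[R]_q := const_mx 1 - A in
  forall (v : V) (tau : pinning E v q), feasible A lam tau ->
    [/\ `|B *m marginal A lam tau| <= alpha / Delta,
        (forall i : {u : V | u != v}, E v (val i) ->
           `|B *m marginal_del A lam tau i| <= alpha / Delta)
      & op_norm (diag_sqrt (\sum_(i : {u : V | u != v} | E v (val i))
                              marginal_del A lam tau i)
                 *m B *m diag_sqrt (marginal A lam tau)) ^+ 2
          <= (1 - eps) / Delta].

Definition gibbs_support (R : realType) (q : nat) (A : 'M[R]_q) (lam : 'cV[R]_q)
    (V : finType) (E : rel V) : finType :=
  {sigma : config V q | 0 < gibbs A lam E sigma}.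

Definition update (V : finType) (q : nat) (sigma : config V q) (v : V)
    (s : 'I_q) : config V q :=
  [ffun u => if u == v then s else sigma u].

Definition glauber (R : realType) (q : nat) (A : 'M[R]_q) (lam : 'cV[R]_q)
    (V : finType) (E : rel V) (x y : gibbs_support A lam E) : R :=
  (#|V|%:R)^-1 * \sum_(v : V) \sum_(s < q | update (val x) v s == val y)
    cprob (gibbs A lam E)
      [pred z : config V q | z v == s]
      [pred z : config V q | [forall u, (u != v) ==> (z u == val x u)]].

Arguments glauber {R q} A lam {V} E x y.

Definition transition_op (R : realType) (S : finType) (P : S -> S -> R)
    (f : S -> R) : S -> R :=
  fun x => \sum_(y : S) P x y * f y.

(* [iter k (transition_op P)] applied to the indicator of [y], evaluated at
   [x], is the [k]-step transition probability from [x] to [y]. *)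
Definition irreducible_chain (R : realType) (S : finType) (P : S -> S -> R) :
    Prop :=
  forall x y : S, exists k : nat,
    0 < iter k (transition_op P) (fun z => (z == y)%:R) x.

Definition inner (R : realType) (S : finType) (mu : S -> R) (f g : S -> R) : R :=
  \sum_(x : S) mu x * f x * g x.

Definition spectral_gap_ge (R : realType) (S : finType) (mu : S -> R)
    (P : S -> S -> R) (gamma : R) : Prop :=
  forall f : S -> R, \sum_(x : S) mu x * f x = 0 ->
    gamma * inner mu f f <= inner mu f (fun x => f x - transition_op P f x).

(* Main.v *)
From HB Require Import structures.
Require Import Defs.
From mathcomp Require Import all_boot all_order all_algebra.
From mathcomp Require Import all_classical all_reals all_analysis.
From mathcomp Require Import ring lra.
From mathcomp Require Import fintype finset.
Import Order.TTheory GRing.Theory Num.Theory.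
Import numFieldNormedType.Exports.
Local Open Scope ring_scope.

(* Write [L_v = 1 - E_v], where [E_v] resamples the spin at [v], and
   [L = \sum_v L_v].  It suffices to prove [g <f, L f> <= <L f, L f>].
   Expanding the square, the terms [<L_u f, L_w f>] with [u], [w] not adjacent
   are nonnegative, as [L_u] and [L_w] commute.  Because of the girth, two
   vertices have at most one common neighbour, and none if they are adjacent, so
   [<L f, L f>] dominates the sum over [v] of the star forms
     1/2 |r|^2 + \sum_i <r, L_i f> + \sum_(i != j) <L_i f, L_j f>
       + 1/(2 Delta) \sum_i |L_i f|^2,     r = L_v f,   i, j ~ v.
   The [L_i], [i ~ v], commute; let [f = \sum_T f_T] be the corresponding
   Efron-Stein decomposition.  Adding [<r, r> - <r, f> = 0] makes every level of
   the star form positive definite, up to the term [- <r_0, g>], where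
   [g = E_v f] and [r_0], the level 0 part of [r], depends only on the spin at
   [v] and on the pinning.  To bound [<r_0, g>], let [m] be the marginal of [v],
   [c(s, x) = A(s, x) / (A m)(x)], [n_i(sigma, s) = (E_i c(s, .))(sigma)] and
     F(sigma) = \sum_s m(s) (r_0(sigma) - r_0(sigma^(v -> s)))
                  \prod_(i ~ v) c(s, sigma_i) / n_i(sigma, s).
   By antisymmetry [E_v F = 0], hence [F] is orthogonal to [g], while the level 0
   part of [F] is [r_0].  So [<r_0, g>] only involves the higher levels of [F]
   and [g].  Condition (2) gives [|F_1|^2 <= (1 - eps + o(1)) / Delta |r_0|^2],
   and condition (1) gives [|F_T|^2 = O(1 / Delta)^(|T| + 1) |r_0|^2] for
   [|T| >= 2], which is negligible even after summing over [T]. *)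

(** * Spectral gap from a Bochner inequality *)

Section Inner.
Context {R : realType} {S : finType}.
Implicit Types (mu f g h : S -> R).

Lemma innerC mu f g : inner mu f g = inner mu g f.
Proof. by apply: eq_bigr => x _; rewrite -mulrA (mulrC (f x)) mulrA. Qed.

Lemma innerDl mu f g h : inner mu (f + g) h = inner mu f h + inner mu g h.
Proof. by rewrite -big_split; apply: eq_bigr => x _ /=; rewrite mulrDr mulrDl. Qed.

Lemma innerZl mu k f h : inner mu (k *: f) h = k * inner mu f h.
Proof.
rewrite /inner mulr_sumr; apply: eq_bigr => x _.
have -> : (k *: f) x = k * f x by [].
by ring.
Qed.

Lemma inner_ge0 mu f : (forall x, 0 <= mu x) -> 0 <= inner mu f f.
Proof.
by move=> mu0; apply: sumr_ge0 => x _; rewrite -mulrA mulr_ge0 // -expr2 sqr_ge0.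
Qed.

Lemma inner_eq0 mu f : (forall x, 0 < mu x) -> inner mu f f = 0 -> f = 0.
Proof.
move=> mu0 /eqP; rewrite psumr_eq0 => [/allP f0|x _]; last first.
  by rewrite -mulrA mulr_ge0 ?(ltW (mu0 x))// -expr2 sqr_ge0.
apply/funext => x; have /f0 /= := mem_index_enum x.
by rewrite -mulrA mulf_eq0 gt_eqF//= mulf_eq0 orbb => /eqP.
Qed.

End Inner.

Section BilinearForm.
Context {R : realType} {W : lmodType R} (b : W -> W -> R).
Hypothesis bC : forall x y, b x y = b y x.
Hypothesis bDl : forall x y z, b (x + y) z = b x z + b y z.
Hypothesis bZl : forall k x z, b (k *: x) z = k * b x z.

Lemma bilDr x y z : b x (y + z) = b x y + b x z.
Proof. by rewrite bC bDl !(bC _ x). Qed.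

Lemma bilZr k x y : b x (k *: y) = k * b x y.
Proof. by rewrite bC bZl bC. Qed.

Lemma bil0l x : b 0 x = 0.
Proof. by rewrite -(scale0r 0) bZl mul0r. Qed.

Lemma bil0r x : b x 0 = 0.
Proof. by rewrite bC bil0l. Qed.

Lemma bilNl x y : b (- x) y = - b x y.
Proof. by rewrite -scaleN1r bZl mulN1r. Qed.

Lemma bilNr x y : b x (- y) = - b x y.
Proof. by rewrite bC bilNl bC. Qed.

Lemma bilBl x y z : b (x - y) z = b x z - b y z.
Proof. by rewrite bDl bilNl. Qed.

Lemma bilBr x y z : b x (y - z) = b x y - b x z.
Proof. by rewrite bilDr bilNr. Qed.

Lemma bil_suml (I : Type) (s : seq I) (P : pred I) (F : I -> W) x :
  b (\sum_(i <- s | P i) F i) x = \sum_(i <- s | P i) b (F i) x.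
Proof. by elim/big_rec2: _ => [|i y z _ <-]; rewrite ?bil0l ?bDl. Qed.

Lemma bil_sumr (I : Type) (s : seq I) (P : pred I) (F : I -> W) x :
  b x (\sum_(i <- s | P i) F i) = \sum_(i <- s | P i) b x (F i).
Proof. by rewrite bC bil_suml; apply: eq_bigr => i _; rewrite bC. Qed.

Hypothesis b_ge0 : forall x, 0 <= b x x.

(** Only semidefiniteness is assumed: the inequality is applied to the Dirichlet form, which
    vanishes on constants, and to weighted inner products whose weights may vanish. Hence the
    separate case [b y y = 0]. *)
Lemma bil_cauchy_schwarz x y : b x y ^+ 2 <= b x x * b y y.
Proof.
have key t : 0 <= b x x - 2 * t * b x y + t ^+ 2 * b y y.
  have := b_ge0 (x - t *: y).
  by rewrite bilBl !bilBr !bZl !bilZr (bC y x); nra.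
have [y0|y0] := eqVneq (b y y) 0; last first.
  have yy : 0 < b y y by rewrite lt_neqAle eq_sym y0 b_ge0.
  have := key (b x y / b y y).
  rewrite -(ler_pM2r yy) mul0r => /le_trans -/(_ _ _); move=> H.
  rewrite -subr_ge0; move: H => /(_ (b x x * b y y - b x y ^+ 2)); apply.
  by rewrite le_eqVlt; apply/orP; left; apply/eqP; field.
rewrite y0 mulr0; have [->|xy] := eqVneq (b x y) 0; first by rewrite expr0n.
(* With [b y y = 0] the polynomial is affine in [t], and this value of [t] makes it equal to -1. *)
have := key ((b x x + 1) / (2 * b x y)); rewrite y0 mulr0 addr0.
have -> : 2 * ((b x x + 1) / (2 * b x y)) * b x y = b x x + 1 by field.
by lra.
Qed.

End BilinearForm.

Section SpectralGap.
Context {R : realType} {S : finType} (mu : S -> R) (P : S -> S -> R).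
Hypothesis mu_gt0 : forall x, 0 < mu x.
Hypothesis P_ge0 : forall x y, 0 <= P x y.
Hypothesis P_sum1 : forall x, \sum_y P x y = 1.
Hypothesis P_irr : irreducible_chain P.

Local Notation T := (transition_op P).

Lemma transition_op_linear : linear (T : (S -> R) -> (S -> R)).
Proof.
move=> k f g; apply/funext => x.
transitivity (k * T f x + T g x) => //.
rewrite /transition_op mulr_sumr -big_split; apply: eq_bigr => y _ /=.
have -> : (k *: f + g) y = k * f y + g y by [].
by ring.
Qed.

Lemma transition_op_mono f g : (forall x, f x <= g x) -> forall x, T f x <= T g x.
Proof. by move=> fg x; apply: ler_sum => y _; rewrite ler_wpM2l. Qed.

(* Maximum principle. *)
Lemma harmonic_constant (f : S -> R) : T f = f -> forall x y, f x = f y.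
Proof.
move=> Tf; suff [[x fx] y z|S0 y] : (exists x, forall y, f y = f x) \/ (forall x : S, False).
  - by rewrite !fx.
  - by case: (S0 y).
have [/card0_eq S0|] := eqVneq #|S| 0%N; first by right => x; have := S0 x.
rewrite -lt0n => /card_gt0P[x0 _]; left.
exists [arg max_(x > x0) f x]%O; case: arg_maxP => // m _ mmax' y.
have mmax z : f z <= f m by exact: mmax'.
have [k Pk] := P_irr m y.
apply/eqP; rewrite eq_le mmax//= leNgt; apply/negP => fym.
set g : S -> R := fun z => f m - f z.
have Tg : T g = g.
  apply/funext => z; have Tfz : T f z = f z by rewrite Tf.
  rewrite /transition_op /g.
  under eq_bigr do rewrite mulrBr.
  by rewrite sumrB -mulr_suml P_sum1 mul1r -[in RHS]Tfz.
(* [g] is nonnegative and fixed by [T], so it dominates [g y] times the [n]-step probability of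
   reaching [y]. At the maximiser [m], where [g] vanishes, irreducibility gives a contradiction. *)
have iter_ge n : forall z, (f m - f y) * iter n T (fun z => (z == y)%:R) z <= g z.
  elim: n => [|n IH] z /=.
    have [->|_] := eqVneq z y; first by rewrite mulr1.
    by rewrite mulr0 subr_ge0 mmax.
  rewrite -Tg; apply: le_trans (transition_op_mono _ _ IH z).
  by rewrite /transition_op mulr_sumr; apply: ler_sum => w _; rewrite mulrCA.
have := iter_ge k m; rewrite /g subrr leNgt mulr_gt0 ?subr_gt0//.
Qed.

Hypothesis P_sym : forall f g, inner mu f (T g) = inner mu (T f) g.

Local Notation lap f := (f - T f).

(* On mean-zero functions [1 - T] is injective; adding the mean makes it
   injective, hence surjective, on the whole space. *)
Lemma poisson_equation (f : S -> R) :
  (forall g, 0 <= inner mu g (lap g)) ->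
  (forall g, inner mu g (lap g) = 0 -> lap g = 0) ->
  \sum_x mu x * f x = 0 -> exists u, lap u = f.
Proof.
move=> lap_ge0 lap0 f0.
pose E g : R := \sum_x mu x * g x.
have E_lap g : E (lap g) = 0.
  have -> : E (lap g) = inner mu (fun=> 1) (lap g).
    by apply: eq_bigr => x _; rewrite mulr1.
  rewrite bilBr; [|exact: innerC|exact: innerDl|exact: innerZl].
  rewrite P_sym; apply/eqP; rewrite subr_eq0; apply/eqP; congr inner.
  by apply/funext => x; rewrite /transition_op; under eq_bigr do rewrite mulr1.
(* Finite functions form a finite-dimensional vector space, where injectivity of [phi] yields
   surjectivity. *)
pose phi (g : {ffun S -> R^o}) : {ffun S -> R^o} := [ffun x => lap (g : S -> R) x + E g].
have phi_lin : linear phi.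
  move=> k g h; apply/ffunP => x; rewrite !ffunE.
  have -> : ((k *: g + h : {ffun S -> R^o}) : S -> R) = (k *: (g : S -> R) + (h : S -> R)).
    by apply/funext => y; rewrite !ffunE.
  have -> : E (k *: (g : S -> R) + (h : S -> R)) = k * E g + E h.
    rewrite /E mulr_sumr -big_split; apply: eq_bigr => y _.
    have -> : (k *: (g : S -> R) + (h : S -> R)) y = k * g y + h y by [].
    by rewrite /=; ring.
  have lapE : lap (k *: (g : S -> R) + (h : S -> R)) x
            = k * g x + h x - (k * T g x + T h x) by rewrite transition_op_linear.
  rewrite lapE.
  transitivity (k * (g x - T g x + E g) + (h x - T h x + E h)); last by [].
  by ring.
pose phiL := GRing.isLinear.Build _ _ _ _ phi phi_lin.
pose Phi : {linear {ffun S -> R^o} -> {ffun S -> R^o}} := HB.pack phi phiL.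
have mass_gt0 (x : S) : 0 < \sum_y mu y.
  by apply: lt_le_trans (mu_gt0 x) _; rewrite (bigD1 x)//= lerDl sumr_ge0// => *; exact: ltW.
have Phi_ker : lker (linfun Phi) == 0%VS.
  rewrite -subv0; apply/subvP => g; rewrite memv_ker lfunE /= => /eqP phi0.
  rewrite memv0; apply/eqP/ffunP => x.
  have lapE : lap (g : S -> R) = fun=> - E g.
    apply/funext => y; have /ffunP/(_ y) := phi0; rewrite !ffunE => /eqP.
    by rewrite addr_eq0 => /eqP.
  have Eg0 : E g = 0.
    have := E_lap g; rewrite lapE /E -mulr_suml => /eqP.
    by rewrite mulf_eq0 (gt_eqF (mass_gt0 x))/= oppr_eq0 => /eqP.
  have Tg : T (g : S -> R) = g.
    apply/funext => y; have /(congr1 (@^~ y)) := lapE.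
    by rewrite Eg0 oppr0 => /eqP; rewrite subr_eq0 => /eqP.
  have gc := harmonic_constant _ Tg.
  move: Eg0; rewrite /E; under eq_bigr do rewrite (gc _ x).
  rewrite -mulr_suml => /eqP; rewrite mulf_eq0 (gt_eqF (mass_gt0 x))/= ffunE.
  by move/eqP.
have : [ffun x => f x] \in limg (linfun Phi).
  by rewrite lker0_limgf// memvf.
case/memv_imgP => u _; rewrite lfunE /= => /ffunP uE; exists u.
have fE x : f x = lap (u : S -> R) x + E u by have := uE x; rewrite !ffunE.
apply/funext => x.
(* Take means in [f = lap u + E u]: both [f] and [lap u] have mean zero. *)
suff Eu : E u = 0 by rewrite fE Eu addr0.
have : E f = E (lap (u : S -> R)) + E u * \sum_y mu y.
  rewrite /E mulr_sumr -big_split; apply: eq_bigr => y _.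
  by rewrite fE /E /=; ring.
rewrite E_lap add0r {1}/E f0 => /esym/eqP.
by rewrite mulf_eq0 (gt_eqF (mass_gt0 x)) orbF => /eqP.
Qed.

(** Solve [f = lap u] and let D be the Dirichlet form. Cauchy-Schwarz gives |f|^4 = D(u, f)^2 <=
    D(u, u) D(f, f), and the assumption at [u] reads gamma D(u, u) <= |f|^2. *)
Lemma spectral_gap_of_bochner (gamma : R) : 0 < gamma ->
  (forall f, 0 <= inner mu f (lap f)) ->
  (forall f, gamma * inner mu f (lap f) <= inner mu (lap f) (lap f)) ->
  spectral_gap_ge mu P gamma.
Proof.
move=> gamma0 lap_ge0 bochner f f0.
have mu_ge0 x : 0 <= mu x by exact: ltW.
pose b g h := inner mu g (lap h).
have bC g h : b g h = b h g.
  rewrite /b !(bilBr (inner mu) (innerC mu) (innerDl mu) (innerZl mu)).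
  by rewrite P_sym innerC (innerC mu (T g)).
have bDl g h k : b (g + h) k = b g k + b h k by exact: innerDl.
have bZl k g h : b (k *: g) h = k * b g h by exact: innerZl.
have cs := bil_cauchy_schwarz b bC bDl bZl lap_ge0.
have [|u uf] := poisson_equation f lap_ge0 _ f0.
  move=> g g0; apply: (inner_eq0 mu _ mu_gt0).
  (* The Dirichlet form of [lap g] and [g] is |lap g|^2, so vanishing energy of [g] forces
     [lap g = 0]. *)
  have := cs (lap g) g; rewrite [b g g]g0 mulr0 => le0.
  by have /eqP := le_anti (introT andP (conj le0 (sqr_ge0 _))); rewrite sqrf_eq0 => /eqP.
have := cs u f; rewrite bC /b uf => csuf.
have := bochner u; rewrite uf => buf.
change (gamma * inner mu f f <= inner mu f (lap f)).
have ff0 := inner_ge0 mu f mu_ge0; have := lap_ge0 f; have uu0 := lap_ge0 u.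
rewrite uf in uu0.
set N := inner mu f f in csuf buf ff0 *; set D := inner mu f (lap f) in csuf *.
set U := inner mu u f in csuf buf uu0 => D0.
have [->|N0] := eqVneq N 0; first by rewrite mulr0.
have {N0 ff0} N0 : 0 < N by rewrite lt_neqAle eq_sym N0.
rewrite -(ler_pM2r N0) -mulrA -expr2.
by apply: le_trans (ler_wpM2l (ltW gamma0) csuf) _; rewrite mulrA mulrC ler_wpM2l.
Qed.

End SpectralGap.

(** * Efron-Stein decomposition for commuting projections *)

Lemma sum_subset_setU1 (W : nmodType) (I : finType) (i : I) (A : {set I})
    (F : {set I} -> W) : i \notin A ->
  \sum_(T : {set I} | T \subset i |: A) F T =
  \sum_(T : {set I} | T \subset A) (F T + F (i |: T)).
Proof.
move=> iA; rewrite (bigID (fun T : {set I} => i \notin T)) /= big_split /=.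
congr (_ + _).
  apply: eq_bigl => T; apply/andP/idP => [[TA iT]|TA].
    by rewrite -(setU1K iA) subsetD1 TA iT.
  split; first exact: subset_trans TA (subsetUr _ _).
  by apply: contra iA; apply/subsetP.
rewrite (reindex_onto (fun T => i |: T) (fun T => T :\ i)) /=; last first.
  by move=> T /andP[_]; rewrite negbK => iT; rewrite setD1K.
apply: eq_bigl => T; rewrite setU11 /= andbT.
apply/andP/idP => [[TA /eqP <-]|TA].
  by rewrite -(setU1K iA) setSD.
have iT : i \notin T by apply: contra iA; apply/subsetP.
by rewrite setU1K// eqxx setUS.
Qed.

Section EfronStein.
Context {R : realType} {W : lmodType R} (b : W -> W -> R).
Hypothesis bC : forall x y, b x y = b y x.
Hypothesis bDl : forall x y z, b (x + y) z = b x z + b y z.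
Hypothesis bZl : forall k x z, b (k *: x) z = k * b x z.
Hypothesis b_ge0 : forall x, 0 <= b x x.
Context {I : finType} (L : I -> {linear W -> W}).

(** With L_i = 1 - E_i this is the product of the L_i for i in T and the E_i for i outside T,
    restricted to the indices in [l]. The fold allows inductions that peel off one index at a
    time. *)
Definition partial_component (l : seq I) (T : {set I}) (x : W) : W :=
  foldr (fun i y => if i \in T then L i y else y - L i y) x l.

Definition component (T : {set I}) (x : W) : W := partial_component (enum I) T x.

Lemma eq_partial_component l (T U : {set I}) x :
  {in l, T =i U} -> partial_component l T x = partial_component l U x.
Proof.
elim: l => //= i l IH TU; rewrite IH => [|j jl]; last by rewrite TU// inE jl orbT.
by rewrite TU// mem_head.
Qed.

Lemma componentB T x y : component T (x - y) = component T x - component T y.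
Proof.
rewrite /component; elim: (enum I) => //= i l ->.
case: ifP => _; rewrite linearB//=.
by rewrite !opprB addrACA [in RHS]addrACA; congr (_ + _); rewrite addrC.
Qed.

Lemma sum_component x : \sum_(T : {set I}) component T x = x.
Proof.
suff key l : uniq l ->
    \sum_(T : {set I} | T \subset [set:: l]) partial_component l T x = x.
  rewrite -[RHS](key _ (enum_uniq I)); apply: eq_bigl => T.
  by apply/esym/subsetP => i _; rewrite inE mem_enum.
elim: l => [_|i l IH /= /andP[il /IH IHl]].
  rewrite (big_pred1 set0)// => T; by rewrite set_nil subset0.
rewrite set_cons sum_subset_setU1 ?inE// -[RHS]IHl; apply: eq_bigr => T Tl /=.
have /negPf iT : i \notin T by apply: contra il => /(subsetP Tl); rewrite inE.
rewrite iT setU11 (@eq_partial_component _ (i |: T) T) ?subrK// => j jl.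
by rewrite !inE; case: eqP => // ji; move: il; rewrite -ji jl.
Qed.

Hypothesis L_idem : forall i x, L i (L i x) = L i x.
Hypothesis L_sym : forall i x y, b (L i x) y = b x (L i y).
Hypothesis L_comm : forall i j x, L i (L j x) = L j (L i x).

Lemma L_component i T x :
  L i (component T x) = if i \in T then component T x else 0.
Proof.
rewrite /component; have : i \in enum I by rewrite mem_enum.
elim: (enum I) => //= j l IH; rewrite inE; have [<- _|ij /= /IH {}IH] := eqVneq.
  by case: ifP => iT; rewrite ?linearB/= L_idem ?subrr.
case: (j \in T); rewrite ?linearB/= L_comm IH; case: (i \in T) => //.
  by rewrite linear0.
by rewrite linear0 subr0.
Qed.

Lemma component_L i T x :
  component T (L i x) = if i \in T then component T x else 0.
Proof.
rewrite -L_component /component; elim: (enum I) => //= j l ->.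
by case: ifP => _; rewrite ?linearB/= L_comm.
Qed.

(** If i lies in one index set and not in the other, L_i fixes one component, kills the other and is
    self-adjoint. *)
Lemma component_orth T U x y : T != U -> b (component T x) (component U y) = 0.
Proof.
have key (A B : {set I}) u v : ~~ (A \subset B) ->
    b (component A u) (component B v) = 0.
  case/subsetPn => i iA /negPf iB.
  have := L_component i A u; rewrite iA => <-.
  by rewrite L_sym L_component iB (bil0r _ bC bZl).
rewrite eqEsubset negb_and => /orP[/key//|/key TU].
by rewrite bC.
Qed.

Lemma form_component x y : b x y = \sum_(T : {set I}) b (component T x) (component T y).
Proof.
rewrite -{1}(sum_component x) (bil_suml _ bDl bZl); apply: eq_bigr => T _.
rewrite -{1}(sum_component y) (bil_sumr _ bC bDl bZl) (bigD1 T)//= big1 ?addr0//.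
by move=> U UT; rewrite component_orth// eq_sym.
Qed.

(** The components are joint eigenvectors of the L_i, and the sum of the L_i multiplies the one
    indexed by T by |T|. *)
Lemma sum_form_L x y : \sum_i b x (L i y) =
  \sum_(T : {set I}) #|T|%:R * b (component T x) (component T y).
Proof.
under eq_bigr do rewrite form_component.
rewrite exchange_big; apply: eq_bigr => T _ /=.
under eq_bigr do rewrite component_L.
rewrite -sum1_card natr_sum mulr_suml [RHS]big_mkcond /=; apply: eq_bigr => i _.
by case: ifP => _; rewrite ?mul1r ?(bil0r _ bC bZl).
Qed.

(** The full double sum is |\sum_i L_i x|^2, with eigenvalue |T|^2; the diagonal terms have
    eigenvalue |T|. *)
Lemma sum_form_LL x :
  \sum_i \sum_(j | j != i) b (L i x) (L j x) =
  \sum_(T : {set I}) #|T|%:R * (#|T|%:R - 1) * b (component T x) (component T x).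
Proof.
transitivity (\sum_i (\sum_j b (L i x) (L j x) - b (L i x) (L i x))).
  by apply: eq_bigr => i _; rewrite [in RHS](bigD1 i)//= [X in X - _]addrC addrK.
rewrite sumrB.
have -> : \sum_i b (L i x) (L i x) = \sum_i b x (L i x).
  by apply: eq_bigr => i _; rewrite L_sym L_idem.
rewrite exchange_big /=.
under eq_bigr => i _ do rewrite -(bil_suml _ bDl bZl).
rewrite !sum_form_L -sumrB; apply: eq_bigr => T _.
suff -> : component T (\sum_i L i x) = #|T|%:R *: component T x.
  by rewrite bZl; ring.
have comp0 : component T 0 = 0 by rewrite -{1}(subrr x) componentB subrr.
have compD : {morph component T : u v / u + v}.
  move=> u v; rewrite -{1}[v]opprK componentB -[- v]sub0r componentB comp0.
  by rewrite sub0r opprK.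
rewrite (big_morph _ compD comp0) /= scaler_nat -sumr_const [RHS]big_mkcond /=.
by apply: eq_bigr => i _; rewrite component_L.
Qed.

(** Level one. Completing a square costs (1 + delta) D / 2 |F|^2 + |f - r|^2 / (2 (1 + delta) D),
    and |f - r|^2 <= (1 + delta) (|f|^2 + |r|^2 / delta). The |f|^2 term is exactly the available
    one; the |r|^2 term is at most |r|^2 as 1 <= 2 delta D. The coefficient of |F|^2 stays close to
    D / 2 because condition (2) bounds D |F_1|^2 only by a factor close to 1. *)
Lemma component_form_ineq1 (D delta gamma : R) (F f r : W) :
  0 < D -> 0 < delta -> gamma <= 1 / 2 -> 1 <= 2 * delta * D ->
  gamma * b r r - (1 + delta) * D / 2 * b F F <=
  3 / 2 * b r r + (2 * D)^-1 * b f f + b F (f - r).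
Proof.
move=> D0 d0 g0 dD.
have H1 := b_ge0 ((1 + delta) * D *: F + (f - r)).
have H2 := b_ge0 (delta *: f + r).
have H3 := b_ge0 r.
rewrite !(bDl, bilDr _ bC bDl, bZl, bilZr _ bC bZl, bilNl _ bZl, bilNr _ bC bZl) in H1 H2 *.
rewrite (bC f F) (bC r F) in H1; rewrite (bC r f) in H1 H2.
set ff := b f f in H1 H2 *; set rr := b r r in H1 H2 H3 *.
set fr := b f r in H1 H2 *; set FF := b F F in H1 *.
set Ff := b F f in H1 *; set Fr := b F r in H1 *.
have d1 : 0 < 1 + delta by lra.
have cD : 0 < (2 * (1 + delta) * D)^-1 by rewrite invr_gt0 !mulr_gt0.
have {}H1 : 0 <= (1 + delta) * D / 2 * FF + (Ff - Fr)
    + (2 * (1 + delta) * D)^-1 * (ff - fr - fr + rr).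
  have := mulr_ge0 (ltW cD) H1; congr (0 <= _); field.
  by rewrite !gt_eqF.
have dDi : 0 < (2 * delta * D)^-1 by rewrite invr_gt0 !mulr_gt0.
have {}H2 : 2 * D * (2 * (1 + delta) * D)^-1 * (ff - fr - fr + rr) <=
            ff + delta^-1 * rr.
  have -> : ff - fr - fr + rr = (1 + delta) * (ff + delta^-1 * rr)
     - delta^-1 * (delta * (delta * ff) + delta * fr + (delta * fr + rr)).
    by field; rewrite gt_eqF.
  have -> : 2 * D * (2 * (1 + delta) * D)^-1 = (1 + delta)^-1.
    by field; rewrite !gt_eqF.
  rewrite mulrBr mulKf ?gt_eqF// gerBl mulrA mulr_ge0 ?mulr_ge0 ?invr_ge0//; lra.
have {}H2 : (2 * (1 + delta) * D)^-1 * (ff - fr - fr + rr) <=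
            (2 * D)^-1 * ff + (2 * delta * D)^-1 * rr.
  have D2 : 0 < 2 * D by rewrite mulr_gt0.
  rewrite -(ler_pM2l D2) mulrA; apply: le_trans H2 _.
  by rewrite le_eqVlt; apply/orP; left; apply/eqP; field; rewrite !gt_eqF.
have H4 : (2 * delta * D)^-1 * rr <= rr.
  by rewrite ler_piMl// invf_le1// mulr_gt0// mulr_gt0.
have H5 : gamma * rr <= 1 / 2 * rr by rewrite ler_wpM2r.
lra.
Qed.

(** Levels two and higher, where a crude coefficient of |F|^2 suffices. Half of |r + (k - 1) f|^2
    absorbs the cross term, and <F, f - r> >= - |F|^2 - |f - r|^2 / 4 >= - |F|^2 - (|f|^2 + |r|^2) /
    2. *)
Lemma component_form_ineq2 (gamma D : R) (k : nat) (F f r : W) :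
  0 < D -> gamma <= 1 / 2 -> (2 <= k)%N ->
  gamma * b r r - b F F <=
  3 / 2 * b r r + (k%:R - 1) * b r f + k%:R * (k%:R - 1) * b f f
    + (2 * D)^-1 * (k%:R * b f f) + b F (f - r).
Proof.
move=> D0 g0; rewrite -(ler_nat R) => k2.
have H1 := b_ge0 (r + (k%:R - 1) *: f).
have H2 := b_ge0 (2 *: F + (f - r)).
have H3 := b_ge0 r; have H4 := b_ge0 f; have H6 := b_ge0 (f + r).
rewrite !(bDl, bilDr _ bC bDl, bZl, bilZr _ bC bZl, bilNl _ bZl, bilNr _ bC bZl) in H1 H2 H6 *.
rewrite (bC f F) (bC r F) in H2; rewrite (bC f r) in H1 H2 H6.
set ff := b f f in H1 H2 H4 H6 *; set rr := b r r in H1 H2 H3 H6 *.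
set fr := b r f in H1 H2 H6 *; set FF := b F F in H2 *.
set Ff := b F f in H2 *; set Fr := b F r in H2 *.
have H5 : gamma * rr <= 1 / 2 * rr by rewrite ler_wpM2r.
have H7 : 0 <= (2 * D)^-1 * (k%:R * ff).
  by rewrite mulr_ge0 ?invr_ge0 ?mulr_ge0// ltW.
(* Removing (k - 1)^2 / 2 from k (k - 1) leaves (k^2 - 1) / 2, which is at least 3 / 2 for k >=
   2. *)
have H8 : 3 / 2 * ff <= k%:R * (k%:R - 1) * ff - 1 / 2 * ((k%:R - 1) * ((k%:R - 1) * ff)).
  rewrite -subr_ge0.
  have -> : k%:R * (k%:R - 1) * ff - 1 / 2 * ((k%:R - 1) * ((k%:R - 1) * ff)) - 3 / 2 * ff
    = 1 / 2 * ((k%:R - 2) * (k%:R + 2) * ff) by field.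
  by rewrite !mulr_ge0//; lra.
lra.
Qed.

(* The hypothesis [b r f = b r r] is used by adding [b r r - b r f = 0] to the
   right-hand side, which turns the level-[k] part of the form into
   [3/2 |r_k|^2 + (k - 1) <r_k, f_k> + k (k - 1) |f_k|^2 + k / (2 D) |f_k|^2]. *)
Lemma star_inequality (D delta gamma k1 zeta : R) (F f r : W) :
  0 < D -> 0 < delta -> gamma <= 1 / 2 -> 1 <= 2 * delta * D ->
  (1 + delta) * k1 + 2 * zeta + 2 * gamma <= 1 ->
  b r f = b r r -> b F (f - r) = 0 -> (forall y, b (component set0 F) y = b (component set0 r) y) ->
  D * \sum_(T : {set I} | #|T| == 1%N) b (component T F) (component T F)
    <= k1 * b (component set0 r) (component set0 r) ->
  \sum_(T : {set I} | (1 < #|T|)%N) b (component T F) (component T F)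
    <= zeta * b (component set0 r) (component set0 r) ->
  gamma * b r r <=
  1 / 2 * b r r + \sum_i b r (L i f) + \sum_i \sum_(j | j != i) b (L i f) (L j f)
    + (2 * D)^-1 * \sum_i b (L i f) (L i f).
Proof.
move=> D0 d0 g0 dD consts rf Fg F0 F1 F2.
have -> : \sum_i b (L i f) (L i f) = \sum_i b f (L i f).
  by apply: eq_bigr => i _; rewrite L_sym L_idem.
rewrite !sum_form_L sum_form_LL.
pose rr (T : {set I}) := b (component T r) (component T r).
pose FF (T : {set I}) := b (component T F) (component T F).
pose ff (T : {set I}) := b (component T f) (component T f).
pose rf' (T : {set I}) := b (component T r) (component T f).
pose Fg' (T : {set I}) := b (component T F) (component T f - component T r).
pose q (T : {set I}) := 3 / 2 * rr T + (#|T|%:R - 1) * rf' T + #|T|%:R * (#|T|%:R - 1) * ff T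
   + (2 * D)^-1 * (#|T|%:R * ff T) + Fg' T.
have brr : b r r = \sum_(T : {set I}) rr T by rewrite form_component.
have -> : 1 / 2 * b r r + \sum_(T : {set I}) #|T|%:R * b (component T r) (component T f) +
   \sum_(T : {set I}) #|T|%:R * (#|T|%:R - 1) * b (component T f) (component T f) +
   (2 * D)^-1 * (\sum_(T : {set I}) #|T|%:R * b (component T f) (component T f)) = \sum_(T : {set I}) q T.
  (* Two zeros are spread over the levels: <F, f - r> and <r, r> - <r, f>. *)
  have e1 : \sum_(T : {set I}) Fg' T = 0.
    rewrite -[RHS]Fg [RHS]form_component; apply: eq_bigr => T _.
    by rewrite componentB.
  have e2 : \sum_(T : {set I}) rf' T = b r r by rewrite -rf [RHS]form_component.
  rewrite /q !big_split /= e1 addr0.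
  under [X in _ = _ + X + _ + _]eq_bigr do rewrite mulrBl mul1r.
  by rewrite sumrB e2 -!mulr_sumr -brr; lra.
rewrite brr mulr_sumr (bigD1 set0)//= [leRHS](bigD1 set0)//=.
(* As F_0 = r_0, the pairing with F cancels - <r_0, f_0> and leaves 3/2 - 1 = 1/2 of |r_0|^2. *)
have q0 : q set0 = 1 / 2 * rr set0.
  rewrite /q /Fg' cards0 F0 /rr /rf' (bilBr _ bC bDl bZl) /=; lra.
have lower T : T != set0 ->
    gamma * rr T - (if #|T| == 1%N then (1 + delta) * D / 2 * FF T else FF T) <= q T.
  rewrite -card_gt0 => T0; rewrite /q; case: eqP => [->|/eqP T1].
    have := component_form_ineq1 D delta gamma (component T F) (component T f) (component T r) D0 d0 g0 dD.
    by rewrite /rr /FF /ff /Fg'; lra.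
  apply: component_form_ineq2 => //.
  by rewrite ltn_neqAle eq_sym T1.
rewrite q0; apply: le_trans (lerD (lexx _) (ler_sum _ lower)).
rewrite sumrB (bigID (fun T : {set I} => #|T| == 1%N) _ (fun T => if _ then _ else _)) /=.
have -> : \sum_(T : {set I} | (T != set0) && (#|T| == 1%N))
   (if #|T| == 1%N then (1 + delta) * D / 2 * FF T else FF T) =
   (1 + delta) / 2 * (D * \sum_(T : {set I} | #|T| == 1%N) FF T).
  rewrite !mulr_sumr; apply: eq_big => [T|T /andP[_ ->]]; last by field.
  by rewrite -card_gt0; case: eqP => [->|]; rewrite ?andbF.
have -> : \sum_(T : {set I} | (T != set0) && (#|T| != 1%N))
   (if #|T| == 1%N then (1 + delta) * D / 2 * FF T else FF T) =
   \sum_(T : {set I} | (1 < #|T|)%N) FF T.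
  apply: eq_big => [T|T /andP[_ /negPf ->]//].
  by rewrite -card_gt0; case: #|T| => [|[|]].
have rr0 : 0 <= rr set0 by exact: b_ge0.
have d1 : 0 <= (1 + delta) / 2 by lra.
(* Half of |r_0|^2 pays for gamma |r_0|^2 and for all higher levels of F; this is the numerical
   hypothesis [consts]. *)
have F1' := ler_wpM2l d1 F1; have := ler_wpM2r rr0 consts.
rewrite -/(rr set0) in F1' F2.
set s1 := \sum_(T | _) FF T in F1' *; set s2 := \sum_(T | _) FF T in F2 *.
set s3 := \sum_(T | _) gamma * _; lra.
Qed.

End EfronStein.

(** * Heat-bath resampling *)

Set Implicit Arguments.
Unset Strict Implicit.
Unset Printing Implicit Defensive.

(** Every orientation of the edges gives the same product. The freedom is used to make a chosen
    vertex a source, which collects its incident edges in one factor. *)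
Lemma weight_orient (R : realType) (q : nat) (A : 'M[R]_q) (lam : 'cV[R]_q)
    (V : finType) (E o : rel V) (sigma : config V q) :
  symmetric E -> irreflexive E -> (forall s t, A s t = A t s) ->
  (forall x y, x != y -> o x y = ~~ o y x) ->
  weight A lam E sigma =
  \prod_x (lam (sigma x) 0 * \prod_(y | E x y && o x y) A (sigma x) (sigma y)).
Proof.
move=> Es Ei As oC; rewrite big_split /= mulrC; congr (_ * _).
rewrite (pair_big_dep xpredT (fun x y => E x y && o x y)
  (fun x y => A (sigma x) (sigma y))) /=.
set lt := fun p : V * V => (enum_rank p.1 < enum_rank p.2)%N.
rewrite (bigID (fun p => o p.1 p.2)) [RHS](bigID lt) /=; congr (_ * _).
  by apply: eq_bigl => p; rewrite -!andbA; congr (_ && _); rewrite andbC.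
rewrite (reindex_inj (h := fun p : V * V => (p.2, p.1))) /=; last first.
  by move=> [x y] [x' y'] /= [-> ->].
apply: eq_big => [[x y]|[x y] _]; rewrite 1?As//= /lt /= Es.
case: (boolP (E x y)) => //= Exy.
have xy : x != y by apply: contraTneq Exy => ->; rewrite Ei.
have nr : enum_rank y != enum_rank x :> nat.
  by rewrite (inj_eq val_inj) (inj_eq enum_rank_inj) eq_sym.
by rewrite (oC x y xy) -leqNgt [in RHS]leq_eqVlt (negPf nr) andbC.
Qed.

Section Update.
Context {V : finType} {q : nat}.
Implicit Types (sigma : config V q) (u v w : V).

Lemma update_same sigma v s : update sigma v s v = s.
Proof. by rewrite ffunE eqxx. Qed.

Lemma update_other sigma v s u : u != v -> update sigma v s u = sigma u.
Proof. by rewrite ffunE => /negPf ->. Qed.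

Lemma update_update sigma v s t : update (update sigma v s) v t = update sigma v t.
Proof. by apply/ffunP => u; rewrite !ffunE; case: eqP. Qed.

Lemma update_id sigma v : update sigma v (sigma v) = sigma.
Proof. by apply/ffunP => u; rewrite !ffunE; case: eqP => // ->. Qed.

Lemma updateC sigma u v s t : u != v ->
  update (update sigma u s) v t = update (update sigma v t) u s.
Proof.
move=> uv; apply/ffunP => w; rewrite !ffunE.
by have [->|//] := eqVneq w v; rewrite eq_sym (negPf uv).
Qed.

End Update.

Section HeatBath.
Context {R : realType} {V : finType} (E : rel V) {q : nat} (A : 'M[R]_q)
  (lam : 'cV[R]_q).
Implicit Types (sigma : config V q) (u v w : V) (f g : config V q -> R).

Definition local_weight v sigma (s : 'I_q) : R :=
  lam s 0 * \prod_(i | E v i) A s (sigma i).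

(* [0 / 0 = 0] here; as the kernel depends on the neighbours of [v] only, the
   identities between resampling operators hold at all configurations, even
   those of weight zero. *)
Definition heat v sigma (s : 'I_q) : R :=
  local_weight v sigma s / \sum_t local_weight v sigma t.

Definition resample v f : config V q -> R :=
  fun sigma => \sum_s heat v sigma s * f (update sigma v s).

Lemma resample_linear v : linear (resample v).
Proof.
move=> k f g; apply/funext => sigma.
transitivity (k * resample v f sigma + resample v g sigma) => //.
rewrite /resample mulr_sumr -big_split; apply: eq_bigr => s _ /=.
have -> : (k *: f + g) (update sigma v s)
        = k * f (update sigma v s) + g (update sigma v s) by [].
by ring.
Qed.

HB.instance Definition _ v := GRing.isLinear.Build R (config V q -> R)
  (config V q -> R) _ (resample v) (resample_linear v).

Definition fluct v : {linear (config V q -> R) -> (config V q -> R)} :=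
  GRing.sub_fun idfun (resample v).

Lemma fluctE v f : fluct v f = f - resample v f.
Proof. by []. Qed.

Hypothesis E_sym : symmetric E.
Hypothesis E_irr : irreflexive E.
Hypothesis A_sym : forall s t, A s t = A t s.
Hypothesis A_ge0 : forall s t, 0 <= A s t.
Hypothesis lam_ge0 : forall s, 0 <= lam s 0.

Lemma local_weight_update v u sigma s t : ~~ E v u ->
  local_weight v (update sigma u t) s = local_weight v sigma s.
Proof.
move=> vu; congr (_ * _); apply: eq_bigr => i vi.
by rewrite update_other//; apply: contraNneq vu => <-.
Qed.

Lemma local_weight_ge0 v sigma s : 0 <= local_weight v sigma s.
Proof. by rewrite mulr_ge0 ?prodr_ge0. Qed.

Lemma heat_update v u sigma s t : ~~ E v u ->
  heat v (update sigma u t) s = heat v sigma s.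
Proof.
move=> vu; rewrite /heat local_weight_update//.
by under eq_bigr do rewrite local_weight_update//.
Qed.

Lemma heat_ge0 v sigma s : 0 <= heat v sigma s.
Proof. by rewrite divr_ge0 ?sumr_ge0// => *; rewrite local_weight_ge0. Qed.

Lemma sum_heat v sigma :
  \sum_s heat v sigma s = (\sum_t local_weight v sigma t != 0)%:R.
Proof.
rewrite -mulr_suml; case: eqP => [->|/eqP Z0]; first by rewrite mul0r.
by rewrite divff.
Qed.

Lemma resample_invariant v f sigma t :
  resample v f (update sigma v t) = resample v f sigma.
Proof.
by apply: eq_bigr => s _; rewrite heat_update ?E_irr// update_update.
Qed.

Lemma resample_idem v f : resample v (resample v f) = resample v f.
Proof.
apply/funext => sigma; rewrite {1}/resample.
under eq_bigr do rewrite resample_invariant.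
rewrite -mulr_suml sum_heat; case: eqP => [Z0|]; last by rewrite mul1r.
rewrite mul0r /resample big1// => s _; rewrite /heat Z0 invr0 mulr0 mul0r //.
Qed.

Lemma resampleC u v f : ~~ E u v -> resample u (resample v f) = resample v (resample u f).
Proof.
move=> uv; have [->//|nuv] := eqVneq u v; apply/funext => sigma; rewrite /resample.
under eq_bigr => s _ do rewrite mulr_sumr.
under [RHS]eq_bigr => s _ do rewrite mulr_sumr.
rewrite exchange_big /=; apply: eq_bigr => t _; apply: eq_bigr => s _.
by rewrite !heat_update// 1?E_sym// updateC// mulrCA.
Qed.

Lemma fluct_idem v f : fluct v (fluct v f) = fluct v f.
Proof. by rewrite !fluctE linearB/= resample_idem subrr subr0. Qed.

Lemma fluctC u v f : ~~ E u v -> fluct u (fluct v f) = fluct v (fluct u f).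
Proof.
move=> uv; rewrite !fluctE !linearB/= (@resampleC u v)//.
by rewrite !opprK -!addrA; congr (_ + _); rewrite addrCA.
Qed.

Local Notation mu := (gibbs A lam E).

(** With the edges oriented so that [v] is a source, the spin at [v] enters through [local_weight]
    alone. *)
Lemma weight_local v : exists2 rest : config V q -> R,
  (forall sigma t, rest (update sigma v t) = rest sigma) /\ (forall sigma, 0 <= rest sigma) &
  forall sigma, weight A lam E sigma = local_weight v sigma (sigma v) * rest sigma.
Proof.
pose o x y := (x == v) || (y != v) && (enum_rank x < enum_rank y)%N.
exists (fun sigma => \prod_(x | x != v)
   (lam (sigma x) 0 * \prod_(y | E x y && o x y) A (sigma x) (sigma y))).
  split=> [sigma t|sigma]; last first.
    by apply: prodr_ge0 => x _; rewrite mulr_ge0// prodr_ge0.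
  apply: eq_bigr => x xv; rewrite update_other//; congr (_ * _).
  apply: eq_bigr => y; rewrite /o (negPf xv) /= => /and3P[_ yv _].
  by rewrite update_other.
move=> sigma; rewrite (@weight_orient _ _ _ _ _ _ o)//; last first.
  move=> x y xy; rewrite /o; have [xv|xv] := eqVneq x v.
    by have /negPf -> : y != v by rewrite -xv eq_sym.
  have [->|yv] //= := eqVneq y v; rewrite -leqNgt [in LHS]ltn_neqAle.
  by rewrite (inj_eq val_inj) (inj_eq enum_rank_inj) xy.
rewrite (bigD1 v)//=; congr (_ * _ * _); apply: eq_bigl => y.
by rewrite /o eqxx andbT.
Qed.

Lemma weight_ge0 sigma : 0 <= weight A lam E sigma.
Proof. by rewrite mulr_ge0 ?prodr_ge0. Qed.

Lemma gibbs_ge0 sigma : 0 <= mu sigma.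
Proof. by rewrite divr_ge0 ?weight_ge0 ?sumr_ge0// => *; rewrite weight_ge0. Qed.

Lemma sum_local_weight_gt0 v sigma : 0 < mu sigma -> 0 < \sum_t local_weight v sigma t.
Proof.
have [rest [_ _] wE] := weight_local v.
move=> mu0; have w0 : weight A lam E sigma != 0.
  by apply: contraTneq mu0; rewrite /gibbs => ->; rewrite mul0r ltxx.
rewrite (bigD1 (sigma v))//= ltr_pwDl ?sumr_ge0// => [|*]; last exact: local_weight_ge0.
rewrite lt_neqAle local_weight_ge0 andbT eq_sym.
by apply: contraNneq w0; rewrite wE => ->; rewrite mul0r.
Qed.

Lemma detailed_balance v sigma s :
  mu sigma * heat v sigma s = mu (update sigma v s) * heat v sigma (sigma v).
Proof.
have [rest [restU _] wE] := weight_local v.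
rewrite /gibbs !wE restU update_same local_weight_update ?E_irr// /heat.
by ring.
Qed.

Lemma resample_sym v f g : inner mu (resample v f) g = inner mu f (resample v g).
Proof.
rewrite /inner /resample.
under eq_bigr => sigma _ do rewrite mulr_sumr mulr_suml.
under [RHS]eq_bigr => sigma _ do rewrite mulr_sumr.
rewrite !pair_big /=.
(* The involution exchanging the current spin at [v] with the proposed one. *)
rewrite (reindex_inj (h := fun p : config V q * 'I_q => (update p.1 v p.2, p.1 v))) /=.
  apply: eq_bigr => [[sigma s] _] /=.
  rewrite heat_update ?E_irr// update_update update_id.
  transitivity (mu (update sigma v s) * heat v sigma (sigma v) *
                (f sigma * g (update sigma v s))); first by ring.
  by rewrite -detailed_balance; ring.
move=> [x s] [y t] /= [xy xvyv]; have /ffunP/(_ v) := xy; rewrite !update_same => <-.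
congr (_, _); apply/ffunP => u; have [->//|uv] := eqVneq u v.
by have /ffunP/(_ u) := xy; rewrite !update_other.
Qed.

Lemma fluct_sym v f g : inner mu (fluct v f) g = inner mu f (fluct v g).
Proof.
rewrite !fluctE (bilBl _ (innerDl mu) (innerZl mu)).
by rewrite (bilBr _ (innerC mu) (innerDl mu) (innerZl mu)) resample_sym.
Qed.

(** For commuting orthogonal projections, <L_u f, L_v f> = |L_u L_v f|^2. *)
Lemma fluct_commute_ge0 u v f : ~~ E u v -> 0 <= inner mu (fluct u f) (fluct v f).
Proof.
move=> uv; have -> : inner mu (fluct u f) (fluct v f) =
                     inner mu (fluct u (fluct v f)) (fluct u (fluct v f)).
  rewrite [RHS]fluct_sym (fluct_idem u (fluct v f)) (fluctC f uv) -[RHS]fluct_sym fluct_idem.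
  exact: innerC.
by apply: inner_ge0 => x; apply: gibbs_ge0.
Qed.

(** [resample v] is self-adjoint and fixes [g] on the support, where the heat-bath kernel has total
    mass 1. *)
Lemma inner_resample_invariant v f g : (forall sigma t, g (update sigma v t) = g sigma) ->
  inner mu g (resample v f) = inner mu g f.
Proof.
move=> gv; rewrite -resample_sym; apply: eq_bigr => sigma _.
have [->|mu0] := eqVneq (mu sigma) 0; first by rewrite !mul0r.
have {}mu0 : 0 < mu sigma by rewrite lt_neqAle eq_sym mu0 gibbs_ge0.
congr (_ * _ * _); rewrite /resample.
under eq_bigr do rewrite gv.
by rewrite -mulr_suml sum_heat gt_eqF ?sum_local_weight_gt0// mul1r.
Qed.

End HeatBath.

(** * The Gibbs law on a star *)

Lemma big_sig (T : Type) (idx : T) (op : Monoid.com_law idx) (I : finType)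
    (P Q : pred I) (F : I -> T) :
  \big[op/idx]_(i | P i && Q i) F i =
  \big[op/idx]_(i : {i : I | P i} | Q (val i)) F (val i).
Proof.
rewrite (reindex_omap (val : {i : I | P i} -> I) insub).
  by apply: eq_bigl => i; rewrite (valP i) valK eqxx andbT.
by move=> i /andP[Pi _]; rewrite insubT.
Qed.

Lemma sum_card1 (W : nmodType) (I : finType) (F : {set I} -> W) :
  \sum_(T : {set I} | #|T| == 1%N) F T = \sum_i F [set i].
Proof.
rewrite (reindex_omap set1 (fun T : {set I} => [pick i in T])) /=.
  apply: eq_bigl => i; rewrite cards1 eqxx /=.
  by case: pickP => [j /set1P ->|/(_ i)]; rewrite ?eqxx// set11.
move=> T /cards1P[i ->]; case: pickP => [j /set1P ->//|/(_ i)].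
by rewrite set11.
Qed.

Section Star.
Context {R : realType} {V : finType} (E : rel V) {q : nat} (A : 'M[R]_q)
  (lam : 'cV[R]_q).
Implicit Types (sigma rho : config V q) (u v w : V).
Hypothesis E_sym : symmetric E.
Hypothesis E_irr : irreflexive E.
Hypothesis A_sym : forall s t, A s t = A t s.
Hypothesis A_ge0 : forall s t, 0 <= A s t.
Hypothesis lam_ge0 : forall s, 0 <= lam s 0.
Hypothesis E_triangle : forall x y z, E x y -> E y z -> ~~ E x z.

(* Orienting the edges away from [v] makes the weight of a star pinned outside
   [N[v]] a product of factors attached to the leaves. *)
Definition layer v u : nat := if u == v then 0%N else if E v u then 1%N else 2%N.

Definition outward v x y : bool :=
  (layer v x < layer v y)%N ||
  (layer v x == layer v y) && (enum_rank x < enum_rank y)%N.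

Definition out_weight v x sigma (a : 'I_q) : R :=
  lam a 0 * \prod_(y | E x y && outward v x y) A a (sigma y).

Definition pin v sigma : pinning E v q := [ffun u => sigma (val u)].

(** For a leaf [i], absence of triangles makes this depend on the spins outside N[v] only; for a
    feasible pinning it is the marginal of [i] in G - v, see [leaf_lawE]. *)
Definition leaf_law v i sigma (a : 'I_q) : R :=
  out_weight v i sigma a / \sum_b out_weight v i sigma b.

(** Up to normalisation, the factor that leaf [i] contributes to the marginal of [v] at spin [s]. *)
Definition leaf_factor v i sigma (s : 'I_q) : R :=
  \sum_a leaf_law v i sigma a * A s a.

Definition center_law v sigma (s : 'I_q) : R := marginal A lam (pin v sigma) s 0.

Lemma outward_total v x y : x != y -> outward v x y = ~~ outward v y x.
Proof.
move=> xy; rewrite /outward; case: ltngtP => //= _.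
rewrite -leqNgt [in LHS]ltn_neqAle.
by rewrite (inj_eq val_inj) (inj_eq enum_rank_inj) xy.
Qed.

Lemma cnbhdE v u : (u \in cnbhd E v) = (u == v) || E v u.
Proof. by rewrite !inE. Qed.

(** Outward edges never decrease the layer, so one starting away from [v] could end in N[v] only by
    joining two leaves, which would close a triangle. *)
Lemma outward_cnbhd v x y : x != v -> E x y -> outward v x y -> y \notin cnbhd E v.
Proof.
rewrite /outward /layer cnbhdE => /negPf -> xy.
have [//|yv] := eqVneq y v; first by case: ifP.
case vy : (E v y) => //=; case vx : (E v x) => //=.
by move: (E_triangle vx xy); rewrite vy.
Qed.

Lemma outward_leaf v i y : E v i -> E i y -> outward v i y = (y != v).
Proof.
move=> vi iy; rewrite /outward /layer vi.
have -> : i == v = false by apply: contraTF vi => /eqP ->; rewrite E_irr.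
by have [//|yv] := eqVneq y v; rewrite (negPf (E_triangle vi iy)).
Qed.

Lemma out_weight_center v sigma a : out_weight v v sigma a = local_weight E A lam v sigma a.
Proof.
congr (_ * _); apply: eq_bigl => y; rewrite /outward /layer eqxx.
case vy : (E v y) => //=.
by have [yv|//] := eqVneq y v; move: vy; rewrite yv E_irr.
Qed.

Lemma eq_out_weight v x sigma rho a : x != v ->
  (forall u, u \notin cnbhd E v -> sigma u = rho u) ->
  out_weight v x sigma a = out_weight v x rho a.
Proof.
move=> xv sr; congr (_ * _); apply: eq_bigr => y /andP[xy o].
by rewrite sr// (outward_cnbhd xv xy o).
Qed.

Lemma weight_out sigma v :
  weight A lam E sigma = \prod_x out_weight v x sigma (sigma x).
Proof.
rewrite (weight_orient _ _ E_sym E_irr A_sym (o := outward v))//.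
by move=> x y; apply: outward_total.
Qed.

Lemma out_weight_ge0 v x sigma a : 0 <= out_weight v x sigma a.
Proof. by rewrite mulr_ge0 ?prodr_ge0. Qed.

Lemma local_weight_leaf v i sigma a : E v i ->
  local_weight E A lam i sigma a = A a (sigma v) * out_weight v i sigma a.
Proof.
move=> vi; rewrite /local_weight /out_weight (bigD1 v)/= 1?E_sym//= mulrCA.
congr (_ * (_ * _)); apply: eq_bigl => y.
by case iy : (E i y) => //=; rewrite (outward_leaf vi iy).
Qed.

Lemma agrees_pin v sigma rho :
  agrees id (pin v sigma) rho = [forall u, (u \notin cnbhd E v) ==> (rho u == sigma u)].
Proof.
apply/'forall_forallP/forallP => [H u|H w u].
  by apply/implyP => uN; have := H u (exist _ u uN); rewrite ffunE /= eqxx.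
apply/implyP => /eqP ->; rewrite ffunE.
by have := H (val u); rewrite (valP u).
Qed.

(** Once the spins at [v] and outside N[v] are fixed, the outward orientation attaches to each leaf
    a factor involving its own spin only. The sum over the leaf spins then factors, by
    distributivity over [family Q]. *)
Lemma sum_weight_star v sigma s :
  \sum_(rho : config V q | (rho v == s) && agrees id (pin v sigma) rho) weight A lam E rho =
  (lam s 0 * \prod_(i | E v i) \sum_a out_weight v i sigma a * A s a) *
  \prod_(x | x \notin cnbhd E v) out_weight v x sigma (sigma x).
Proof.
pose F x a := if x == v then lam a 0 else
  out_weight v x sigma a * (if E v x then A s a else 1).
pose Q x := if x == v then pred1 s else if E v x then predT else pred1 (sigma x).
transitivity (\sum_(rho : config V q | rho \in family Q) \prod_x F x (rho x)).
  apply: eq_big => [rho|rho /andP[/eqP rv]].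
    rewrite agrees_pin; apply/andP/familyP => [[/eqP rv /forallP H] x|H].
      rewrite /Q; case: eqP => [->|/eqP xv]; first by rewrite inE rv.
      case: ifP => // vx; rewrite inE.
      by have := H x; rewrite cnbhdE (negPf xv) vx.
    split; first by have := H v; rewrite /Q eqxx inE.
    apply/forallP => x; apply/implyP; rewrite cnbhdE negb_or => /andP[xv vx].
    by have := H x; rewrite /Q (negPf xv) (negPf vx) inE.
  rewrite agrees_pin => /forallP H.
  rewrite (weight_out rho v) (bigD1 v)//= [RHS](bigD1 v)//= {1}/F eqxx rv.
  rewrite out_weight_center /local_weight -mulrA; congr (_ * _).
  have -> : \prod_(i | E v i) A s (rho i) =
            \prod_(i | i != v) (if E v i then A s (rho i) else 1).
    rewrite -big_mkcondr; apply: eq_bigl => i.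
    by case vi: (E v i); rewrite ?andbF// andbT; apply/esym; apply: contraTneq vi => ->; rewrite E_irr.
  rewrite -big_split /=; apply: eq_bigr => x xv; rewrite /F (negPf xv) mulrC.
  congr (_ * _); apply: eq_out_weight => // u uN.
  by have := H u; rewrite uN => /eqP.
rewrite -bigA_distr_big_dep (bigD1 v)//= {1}/Q {1}/F eqxx big_pred1_eq -mulrA.
congr (_ * _); rewrite (bigID (E v)) /=; congr (_ * _).
  apply: eq_big => [i|i /andP[iv vi]].
    by case vi: (E v i); rewrite ?andbF// andbT; apply: contraTneq vi => ->; rewrite E_irr.
  by rewrite /Q /F (negPf iv) vi.
apply: eq_big => [x|x /andP[xv vx]]; first by rewrite cnbhdE negb_or.
by rewrite /Q (negPf xv) (negPf vx) big_pred1_eq /F (negPf xv) (negPf vx) mulr1.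
Qed.

(** The contribution of the vertices other than [i]; it does not depend on the spin at [i] and
    cancels in the conditional law. *)
Definition del_rest v sigma (i : {u : V | u != v}) : R :=
  \prod_(x | x != i) \sum_(b | (if E v (val x) then predT else pred1 (sigma (val x))) b)
    out_weight v (val x) sigma b.

Lemma sum_weight_star_del v sigma (i : {u : V | u != v}) a : E v (val i) ->
  \sum_(rho : config {u : V | u != v} q | (rho i == a) && agrees val (pin v sigma) rho)
    weight A lam (del_vertex E (v := v)) rho =
  out_weight v (val i) sigma a * del_rest sigma i.
Proof.
move=> vi; pose F (x : {u : V | u != v}) a := out_weight v (val x) sigma a.
pose Q a (x : {u : V | u != v}) := if x == i then pred1 a
  else if E v (val x) then predT else pred1 (sigma (val x)).
transitivity (\sum_(rho : config {u : V | u != v} q | rho \in family (Q a)) \prod_x F x (rho x)).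
  apply: eq_big => [rho|rho /andP[/eqP ri]].
    apply/andP/familyP => [[/eqP rv /'forall_forallP H] x|H].
      rewrite /Q; case: eqP => [->|/eqP xv]; first by rewrite inE rv.
      case: ifP => // vx; rewrite inE.
      have xN : val x \notin cnbhd E v by rewrite cnbhdE negb_or (valP x) vx.
      by have := H x (exist (fun u => u \notin cnbhd E v) _ xN); rewrite ffunE /= eqxx.
    split; first by have := H i; rewrite /Q eqxx inE.
    apply/'forall_forallP => x u; apply/implyP => /eqP xu; rewrite ffunE -xu.
    have := valP u; rewrite -xu cnbhdE negb_or => /andP[xv vx].
    have := H x; rewrite /Q (negPf vx); case: eqP => [xi|_]; last by rewrite inE.
    by move: vx; rewrite xi vi.
  move=> /'forall_forallP H.
  rewrite (@weight_orient _ _ _ _ _ _ (fun x y => outward v (val x) (val y)))//; first last.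
  - by move=> x y xy; apply: outward_total; rewrite (inj_eq val_inj).
  - by move=> x; apply: E_irr.
  - by move=> x y; apply: E_sym.
  apply: eq_bigr => x _; congr (_ * _).
  rewrite [RHS](eq_bigl (fun y => (y != v) && (E (val x) y && outward v (val x) y))); last first.
    move=> y; case: eqP => //= ->.
    by rewrite /outward /layer eqxx (negPf (valP x)); case: ifP => _; rewrite andbF.
  rewrite (big_sig _ (fun y => y != v)); apply: eq_bigr => y /andP[xy o]; congr (A _ _).
  have yN := outward_cnbhd (valP x) xy o.
  by have := H y (exist (fun u => u \notin cnbhd E v) _ yN); rewrite ffunE /= eqxx => /eqP.
rewrite -bigA_distr_big_dep (bigD1 i)//= {1}/Q eqxx big_pred1_eq; congr (_ * _).
by apply: eq_bigr => x /negPf xi; rewrite /Q xi.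
Qed.

Lemma cprob_gibbs (W : finType) (D : rel W) (X Y : pred (config W q)) :
  \sum_rho weight A lam D rho != 0 ->
  cprob (gibbs A lam D) X Y =
  (\sum_(rho | X rho && Y rho) weight A lam D rho) / \sum_(rho | Y rho) weight A lam D rho.
Proof.
move=> Z0; rewrite /cprob /prob /gibbs -!mulr_suml invfM invrK mulrACA mulVf ?mulr1//.
Qed.

(** Feasibility of the pinning induced by [sigma]. Unlike positivity of [sigma] itself, it is stable
    under updates inside N[v]. *)
Definition good v sigma : bool := 0 < prob (gibbs A lam E) (agrees id (pin v sigma)).

Local Notation mu := (gibbs A lam E).

Lemma good_gibbs v sigma : 0 < mu sigma -> good v sigma.
Proof.
move=> mu0; rewrite /good /prob (bigD1 sigma)/=; last first.
  by rewrite agrees_pin; apply/forallP => u; rewrite eqxx implybT.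
by rewrite ltr_pwDl// sumr_ge0// => *; apply: gibbs_ge0.
Qed.

Section Good.
Variables (v : V) (sigma : config V q).
Hypothesis sigma_good : good v sigma.

Lemma partition_function_gt0 : 0 < \sum_rho weight A lam E rho.
Proof.
rewrite lt_neqAle sumr_ge0 ?andbT => [|*]; last exact: weight_ge0.
apply: contraTneq sigma_good => Z0.
by rewrite /good /prob big1 ?ltxx// => rho _; rewrite /gibbs -Z0 invr0 mulr0.
Qed.

Let rest := \prod_(x | x \notin cnbhd E v) out_weight v x sigma (sigma x).
Let star s := lam s 0 * \prod_(i | E v i) \sum_a out_weight v i sigma a * A s a.

Let sum_agrees : \sum_(rho : config V q | agrees id (pin v sigma) rho) weight A lam E rho =
  (\sum_s star s) * rest.
Proof.
rewrite mulr_suml (partition_big (fun rho : config V q => rho v) predT)//=.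
by apply: eq_bigr => s _; rewrite -sum_weight_star; apply: eq_bigl => rho; rewrite andbC.
Qed.

Let star_ge0 s : 0 <= star s.
Proof.
rewrite mulr_ge0// prodr_ge0// => i _; rewrite sumr_ge0// => a _.
by rewrite mulr_ge0 ?out_weight_ge0.
Qed.

Let sum_star_rest_gt0 : 0 < (\sum_s star s) * rest.
Proof.
have := sigma_good; rewrite /good /prob /gibbs -mulr_suml sum_agrees.
by rewrite pmulr_lgt0// invr_gt0 partition_function_gt0.
Qed.

Let rest_gt0 : 0 < rest.
Proof.
rewrite lt_neqAle prodr_ge0 ?andbT => [|*]; last exact: out_weight_ge0.
by apply: contraTneq sum_star_rest_gt0 => <-; rewrite mulr0 ltxx.
Qed.

Let sum_star_gt0 : 0 < \sum_s star s.
Proof. by have := sum_star_rest_gt0; rewrite pmulr_lgt0. Qed.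

Lemma sum_out_weight_gt0 i : E v i -> 0 < \sum_a out_weight v i sigma a.
Proof.
move=> vi; rewrite lt_neqAle sumr_ge0 ?andbT => [|*]; last exact: out_weight_ge0.
apply: contraTneq sum_star_gt0 => /esym/eqP.
rewrite psumr_eq0 => [/allP H|*]; last exact: out_weight_ge0.
rewrite big1 ?ltxx// => s _; rewrite /star (bigD1 i)//= big1 ?mul0r ?mulr0// => a _.
by have /= /eqP -> := H a (mem_index_enum _); rewrite mul0r.
Qed.

Lemma center_lawE s : center_law v sigma s = star s / \sum_t star t.
Proof.
rewrite /center_law mxE cprob_gibbs ?gt_eqF ?partition_function_gt0//.
rewrite sum_agrees sum_weight_star -/rest -/(star s).
by rewrite invfM mulrACA divff ?mulr1// gt_eqF.
Qed.

Lemma center_law_ge0 s : 0 <= center_law v sigma s.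
Proof. by rewrite center_lawE divr_ge0// ltW. Qed.

Lemma sum_center_law : \sum_s center_law v sigma s = 1.
Proof.
under eq_bigr do rewrite center_lawE.
by rewrite -mulr_suml divff// gt_eqF.
Qed.

Lemma leaf_law_ge0 i a : 0 <= leaf_law v i sigma a.
Proof. by rewrite divr_ge0 ?sumr_ge0// => *; rewrite out_weight_ge0. Qed.

Lemma sum_leaf_law i : E v i -> \sum_a leaf_law v i sigma a = 1.
Proof. by move=> vi; rewrite -mulr_suml divff// gt_eqF// sum_out_weight_gt0. Qed.

Lemma center_law_factor : exists2 c : R, 0 < c & forall s,
  center_law v sigma s = c * (lam s 0 * \prod_(i | E v i) leaf_factor v i sigma s).
Proof.
exists ((\prod_(i | E v i) \sum_a out_weight v i sigma a) / \sum_t star t).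
  by rewrite divr_gt0// prodr_gt0// => i; apply: sum_out_weight_gt0.
move=> s; rewrite center_lawE [RHS]mulrAC; congr (_ * _).
rewrite /star mulrCA; congr (_ * _); rewrite -big_split /=.
apply: eq_bigr => i vi; rewrite /leaf_factor mulr_sumr.
apply: eq_bigr => a _; rewrite /leaf_law; field.
by rewrite gt_eqF// sum_out_weight_gt0.
Qed.

Lemma del_rest_gt0 (i : {u : V | u != v}) : 0 < del_rest sigma i.
Proof.
apply: prodr_gt0 => x _; case: ifP => vx; first exact: sum_out_weight_gt0.
rewrite big_pred1_eq lt_neqAle out_weight_ge0 andbT eq_sym.
have := rest_gt0; rewrite /rest (bigD1 (val x))/=.
  by apply: contraTneq => ->; rewrite mul0r ltxx.
by rewrite cnbhdE negb_or (valP x) vx.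
Qed.

Lemma leaf_lawE (i : {u : V | u != v}) a : E v (val i) ->
  marginal_del A lam (pin v sigma) i a 0 = leaf_law v (val i) sigma a.
Proof.
move=> vi; pose W : finType := {u : V | u != v}.
have C0 := del_rest_gt0 i.
have sumE : \sum_(rho : config W q | agrees val (pin v sigma) rho)
    weight A lam (del_vertex E (v := v)) rho
   = (\sum_b out_weight v (val i) sigma b) * del_rest sigma i.
  rewrite mulr_suml (partition_big (fun rho : config W q => rho i) predT)//=.
  by apply: eq_bigr => b _; rewrite -sum_weight_star_del//; apply: eq_bigl => rho; rewrite andbC.
have S0 := sum_out_weight_gt0 vi.
have W0 (rho : config W q) : 0 <= weight A lam (del_vertex E (v := v)) rho.
  by rewrite mulr_ge0 ?prodr_ge0.
rewrite mxE cprob_gibbs.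
  by rewrite sumE sum_weight_star_del// invfM mulrACA divff ?mulr1// gt_eqF.
rewrite gt_eqF// (bigID (agrees val (pin v sigma)))/= sumE.
by rewrite ltr_pwDl ?mulr_gt0// sumr_ge0.
Qed.

End Good.
(** Bayes' rule: given the spin at [v], the law of leaf [i] is its law in G - v reweighted by the
    edge to [v]. *)
Lemma heat_leaf v i sigma a : good v sigma -> E v i ->
  heat E A lam i sigma a =
  leaf_law v i sigma a * A a (sigma v) / leaf_factor v i sigma (sigma v).
Proof.
move=> gs vi; have S0 := sum_out_weight_gt0 gs vi.
have -> : leaf_factor v i sigma (sigma v) =
    (\sum_b local_weight E A lam i sigma b) / \sum_b out_weight v i sigma b.
  rewrite mulr_suml; apply: eq_bigr => b _.
  by rewrite (local_weight_leaf _ _ vi) /leaf_law (A_sym (sigma v)); ring.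
rewrite /heat (local_weight_leaf _ _ vi) /leaf_law invf_div.
set Y := \sum_t local_weight _ _ _ _ _ _.
(* If the total local weight vanishes, both sides are 0 by the convention for division by 0. *)
have [->|Y0] := eqVneq Y 0; first by rewrite !(invr0, mulr0).
by field; rewrite Y0 gt_eqF.
Qed.

Lemma pin_update v u sigma t : u \in cnbhd E v -> pin v (update sigma u t) = pin v sigma.
Proof.
move=> uN; apply/ffunP => w; rewrite !ffunE; case: eqP => // wu.
by have := valP w; rewrite wu uN.
Qed.

Lemma center_law_update v u sigma t s : u \in cnbhd E v ->
  center_law v (update sigma u t) s = center_law v sigma s.
Proof. by move=> uN; rewrite /center_law pin_update. Qed.

Lemma good_update v u sigma t : u \in cnbhd E v -> good v (update sigma u t) = good v sigma.
Proof. by move=> uN; rewrite /good pin_update. Qed.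

Lemma leaf_law_update v u sigma t i a : u \in cnbhd E v -> E v i ->
  leaf_law v i (update sigma u t) a = leaf_law v i sigma a.
Proof.
move=> uN vi; have iv : i != v by apply: contraTneq vi => ->; rewrite E_irr.
have eqw b : out_weight v i (update sigma u t) b = out_weight v i sigma b.
  apply: eq_out_weight => // w wN; rewrite update_other//.
  by apply: contraNneq wN => ->.
by rewrite /leaf_law eqw; under eq_bigr do rewrite eqw.
Qed.

(** These are the functions of the spins at [v] and outside N[v]; level 0 components have this
    form. *)
Definition leaf_invariant v (Y : config V q -> R) : Prop :=
  forall sigma i t, E v i -> Y (update sigma i t) = Y sigma.

Lemma leaf_invariant_eq v Y sigma rho : leaf_invariant v Y ->
  (forall u, ~~ E v u -> sigma u = rho u) -> Y sigma = Y rho.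
Proof.
move=> Yinv sr.
have key (l : seq V) : Y [ffun u => if u \in l then sigma u else rho u] = Y rho.
  elim: l => [|i l <-]; first by congr Y; apply/ffunP => u; rewrite ffunE.
  case vi : (E v i).
    rewrite -[RHS](Yinv _ i (sigma i))//; congr Y; apply/ffunP => u.
    by rewrite !ffunE inE; case: eqP => // ->.
  congr Y; apply/ffunP => u; rewrite !ffunE inE; case: eqP => // ->/=.
  by case: ifP => // _; rewrite sr ?vi.
rewrite -(key (enum V)); congr Y; apply/ffunP => u.
by rewrite ffunE mem_enum.
Qed.

Lemma agrees_pinC v sigma rho : agrees id (pin v sigma) rho = agrees id (pin v rho) sigma.
Proof. by rewrite !agrees_pin; apply: eq_forallb => u; rewrite eq_sym. Qed.

Lemma agrees_pin_eq v sigma rho : agrees id (pin v sigma) rho -> pin v sigma = pin v rho.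
Proof.
rewrite agrees_pin => /forallP H; apply/ffunP => u; rewrite !ffunE.
by have := H (val u); rewrite (valP u) => /eqP.
Qed.

Local Notation pinprob v sigma := (prob mu (agrees id (pin v sigma))).

(** Both sides are the conditional expectation of [Y] given the pinning: [Y] ignores the leaves, so
    only the marginal at [v] matters. *)
Lemma sum_center_law_fun v sigma Y : leaf_invariant v Y ->
  \sum_s center_law v sigma s * Y (update sigma v s) =
  (\sum_(rho | agrees id (pin v sigma) rho) mu rho * Y rho) / pinprob v sigma.
Proof.
move=> Yinv; rewrite mulr_suml.
rewrite (partition_big (fun rho : config V q => rho v) predT)//=; apply: eq_bigr => s _.
rewrite /center_law mxE /cprob /prob /= mulrAC !mulr_suml.
apply: eq_big => [rho|rho /andP[/eqP rv Hr]]; first by rewrite andbC.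
congr (_ * _ / _); apply: (leaf_invariant_eq Yinv) => u vu; rewrite ffunE.
case: eqP => [->//|/eqP uv]; move: Hr; rewrite agrees_pin => /forallP/(_ u).
by rewrite cnbhdE (negPf uv) (negPf vu) => /eqP.
Qed.

Lemma gibbs_good v sigma : ~~ good v sigma -> mu sigma = 0.
Proof.
move=> ng; apply/eqP; rewrite -[_ == _]negbK; apply: contra ng => m0.
by apply: good_gibbs; rewrite lt_neqAle eq_sym m0 gibbs_ge0.
Qed.

Lemma mean_center_law v Y : leaf_invariant v Y ->
  \sum_sigma mu sigma * (\sum_s center_law v sigma s * Y (update sigma v s)) =
  \sum_sigma mu sigma * Y sigma.
Proof.
move=> Yinv; under eq_bigr => sigma _.
  rewrite (sum_center_law_fun _ Yinv) mulrCA mulrA mulr_suml mulr_suml big_mkcond /=.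
over.
rewrite exchange_big; apply: eq_bigr => rho _ /=; rewrite -big_mkcond /=.
have [gr|ng] := boolP (good v rho); last first.
  by rewrite (gibbs_good ng) mul0r big1// => *; rewrite !mul0r.
rewrite (eq_bigl (agrees id (pin v rho))) => [|sigma]; last by rewrite agrees_pinC.
rewrite (eq_bigr (fun sigma => mu sigma * (mu rho * Y rho / pinprob v rho))); last first.
  by move=> sigma /agrees_pin_eq <-; ring.
by rewrite -mulr_suml mulrC mulfVK// gt_eqF.
Qed.

(** Set to 0 at vertices that are not leaves, so that the decomposition can be indexed by all of
    [V]; components whose index set is not contained in N(v) then vanish. *)
Definition star_fluct v i : {linear (config V q -> R) -> (config V q -> R)} :=
  if E v i then fluct E A lam i else GRing.null_fun _.

Lemma star_fluct_invariant v i f g : leaf_invariant v g ->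
  inner mu g (f - star_fluct v i f) = inner mu g f.
Proof.
move=> gv; rewrite /star_fluct; case: ifP => vi; last by rewrite subr0.
rewrite fluctE opprB addrCA subrr addr0; apply: inner_resample_invariant => //.
by move=> sigma t; apply: gv.
Qed.

Lemma component0_inner v f g : leaf_invariant v g ->
  inner mu g (component (star_fluct v) set0 f) = inner mu g f.
Proof.
move=> gv; rewrite /component; elim: (enum V) => //= i l IH.
by rewrite inE star_fluct_invariant.
Qed.

Lemma star_fluct_idem v i f : star_fluct v i (star_fluct v i f) = star_fluct v i f.
Proof. by rewrite /star_fluct; case: ifP => // _; rewrite fluct_idem. Qed.

Lemma star_fluct_sym v i f g :
  inner mu (star_fluct v i f) g = inner mu f (star_fluct v i g).
Proof.
rewrite /star_fluct; case: ifP => _; first exact: fluct_sym.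
by rewrite (bil0l _ (innerZl mu)) (bil0r _ (innerC mu) (innerZl mu)).
Qed.

Lemma star_fluctC v i j f :
  star_fluct v i (star_fluct v j f) = star_fluct v j (star_fluct v i f).
Proof.
rewrite /star_fluct; case vi : (E v i); case vj : (E v j); rewrite ?linear0//.
by apply: fluctC => //; apply: contraTN vj => /(E_triangle vi).
Qed.

Lemma component0_invariant v f : leaf_invariant v (component (star_fluct v) set0 f).
Proof.
move=> sigma i t vi; set h := component _ _ _.
have hE : resample E A lam i h = h.
  have := L_component _ (@star_fluct_idem v) (@star_fluctC v) i set0 f.
  rewrite inE -/h {1}/star_fluct vi fluctE => /eqP.
  by rewrite subr_eq0 => /eqP <-.
by rewrite -hE resample_invariant.
Qed.

(** Up to normalisation the sum tests the level 0 part of L_v f against the indicator of the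
    pinning. Resampling inside N[v] does not affect the indicator, so it may be tested against L_v f
    itself, whose mean given the pinning is 0. *)
Lemma component0_center_mean v f sigma :
  \sum_s center_law v sigma s *
    component (star_fluct v) set0 (fluct E A lam v f) (update sigma v s) = 0.
Proof.
rewrite sum_center_law_fun; last exact: component0_invariant.
set h := component _ _ _; pose g rho : R := (agrees id (pin v sigma) rho)%:R.
have gU u rho t : u \in cnbhd E v -> g (update rho u t) = g rho.
  by move=> uN; rewrite /g agrees_pinC [in RHS]agrees_pinC pin_update.
have -> : \sum_(rho | agrees id (pin v sigma) rho) mu rho * h rho = inner mu g h.
  rewrite big_mkcond; apply: eq_bigr => rho _; rewrite /g.
  by case: ifP => _; rewrite ?mulr1 ?mulr0 ?mul0r.
rewrite component0_inner => [|rho i t vi]; last by rewrite gU// cnbhdE vi orbT.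
rewrite fluctE (bilBr _ (innerC mu) (innerDl mu) (innerZl mu)).
rewrite inner_resample_invariant ?subrr ?mul0r// => rho t.
by rewrite gU// cnbhdE eqxx.
Qed.

(** * The test function of a star and its components under the contraction bounds *)

Section Contraction.
Variables (v : V) (a : R).
Hypothesis A_le1 : forall s t, A s t <= 1.
Hypothesis a_ge0 : 0 <= a.
Hypothesis a_small : a <= 1 / 12.
Hypothesis center_bound : forall sigma, good v sigma -> forall x,
  \sum_s (1 - A x s) * center_law v sigma s <= a.
Hypothesis leaf_bound : forall sigma, good v sigma -> forall i, E v i -> forall s,
  \sum_y (1 - A s y) * leaf_law v i sigma y <= a.

Ltac a_lra := move: (a_ge0) (a_small); lra.

Definition center_mean sigma x : R := \sum_s center_law v sigma s * A x s.

(** The ratio c(s, x) of the initial outline. On feasible pinnings, division by [center_mean] gives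
    it mean 1 over [s] under [center_law]. *)
Definition tilt sigma s x : R := A s x / center_mean sigma x.

Definition tilt_mean i sigma s : R := \sum_x heat E A lam i sigma x * tilt sigma s x.

(** Normalised to have conditional mean 1 when leaf [i] is resampled, which makes the components of
    a product of these factors explicit. *)
Definition tilt_factor s i sigma : R := tilt sigma s (sigma i) / tilt_mean i sigma s.

Let leaf_neq i : E v i -> i != v.
Proof. by apply: contraTneq => ->; rewrite E_irr. Qed.

Let leaf_cnbhd i : E v i -> i \in cnbhd E v.
Proof. by move=> vi; rewrite cnbhdE vi orbT. Qed.

Let leaf_leaf i j : E v i -> E v j -> ~~ E i j.
Proof. by move=> vi vj; apply: contraTN vj => /(E_triangle vi). Qed.

Lemma center_mean_update u sigma t x : u \in cnbhd E v ->
  center_mean (update sigma u t) x = center_mean sigma x.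
Proof.
by move=> uN; apply: eq_bigr => s _; rewrite center_law_update.
Qed.

Lemma tilt_update u sigma t s x : u \in cnbhd E v ->
  tilt (update sigma u t) s x = tilt sigma s x.
Proof. by move=> uN; rewrite /tilt center_mean_update. Qed.

Lemma tilt_mean_update i j sigma t s : E v i -> E v j ->
  tilt_mean i (update sigma j t) s = tilt_mean i sigma s.
Proof.
move=> vi vj; apply: eq_bigr => x _.
by rewrite (heat_update _ _ _ _ _ (leaf_leaf vi vj)) (tilt_update _ _ _ _ (leaf_cnbhd vj)).
Qed.

Lemma tilt_factor_update i j sigma t s : E v i -> E v j -> i != j ->
  tilt_factor s i (update sigma j t) = tilt_factor s i sigma.
Proof.
move=> vi vj ij; rewrite /tilt_factor tilt_mean_update// tilt_update ?leaf_cnbhd//.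
by rewrite update_other.
Qed.

Section GoodBounds.
Variable sigma : config V q.
Hypothesis gs : good v sigma.

Lemma center_mean_ge x : 1 - a <= center_mean sigma x.
Proof.
have := center_bound gs x.
have -> : \sum_s (1 - A x s) * center_law v sigma s = 1 - center_mean sigma x.
  by rewrite -[X in _ = X - _](sum_center_law gs) -sumrB; apply: eq_bigr => s _; ring.
by a_lra.
Qed.

Lemma center_mean_le1 x : center_mean sigma x <= 1.
Proof.
rewrite -(sum_center_law gs); apply: ler_sum => s _.
by rewrite ler_piMr// center_law_ge0.
Qed.

Lemma leaf_factor_ge i s : E v i -> 1 - a <= leaf_factor v i sigma s.
Proof.
move=> vi; have := leaf_bound gs vi s.
have -> : \sum_y (1 - A s y) * leaf_law v i sigma y = 1 - leaf_factor v i sigma s.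
  by rewrite -[X in _ = X - _](sum_leaf_law gs vi) -sumrB; apply: eq_bigr => y _; ring.
by a_lra.
Qed.

Lemma leaf_factor_gt0 i s : E v i -> 0 < leaf_factor v i sigma s.
Proof. by move=> vi; have := leaf_factor_ge s vi; a_lra. Qed.

Lemma sum_heat_leaf i : E v i -> \sum_x heat E A lam i sigma x = 1.
Proof.
move=> vi; under eq_bigr do rewrite (heat_leaf _ gs vi) (A_sym _ (sigma v)).
rewrite -mulr_suml -/(leaf_factor v i sigma (sigma v)) divff// gt_eqF//.
exact: leaf_factor_gt0.
Qed.

Lemma heat_le i x : E v i ->
  heat E A lam i sigma x <= leaf_law v i sigma x / (1 - a).
Proof.
move=> vi; rewrite (heat_leaf _ gs vi); have lf := leaf_factor_ge (sigma v) vi.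
have a1 : 0 < 1 - a by a_lra.
have lf0 := leaf_factor_gt0 (sigma v) vi.
apply: le_trans (_ : leaf_law v i sigma x / leaf_factor v i sigma (sigma v) <= _).
  by rewrite ler_wpM2r ?invr_ge0 ?(ltW lf0)// ler_piMr// leaf_law_ge0.
by rewrite ler_wpM2l ?leaf_law_ge0// lef_pV2 ?posrE.
Qed.

Lemma heat_le2 i x : E v i ->
  heat E A lam i sigma x <= 2 * leaf_law v i sigma x.
Proof.
move=> vi; apply: le_trans (heat_le x vi) _; rewrite mulrC ler_wpM2r ?leaf_law_ge0//.
by rewrite -[leRHS]invrK lef_pV2 ?posrE; a_lra.
Qed.

(** A common majorant, up to constants, for the deviations of the tilts from 1. Its mean is O(a)
    both over [s] under [center_law] and over [x] under the heat-bath law of a leaf; the summand [a]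
    covers the errors in the normalisations. *)
Definition defect s x : R := a + (1 - A s x).

Lemma defect_ge0 s x : 0 <= defect s x.
Proof. by have := A_le1 s x; rewrite /defect; a_lra. Qed.

Lemma defect_le2 s x : defect s x <= 2.
Proof. by have := A_ge0 s x; rewrite /defect; a_lra. Qed.

Lemma mean_defect i s : E v i -> \sum_x heat E A lam i sigma x * defect s x <= 3 * a.
Proof.
move=> vi; under eq_bigr do rewrite /defect mulrDr.
rewrite big_split /= -mulr_suml sum_heat_leaf// mul1r.
suff : \sum_x heat E A lam i sigma x * (1 - A s x) <= 2 * a by a_lra.
apply: le_trans (ler_wpM2l _ (leaf_bound gs vi s)) => //.
rewrite mulr_sumr; apply: ler_sum => x _; rewrite mulrCA mulrC ler_wpM2l ?heat_le2//.
by rewrite subr_ge0.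
Qed.

Lemma center_defect x : \sum_s center_law v sigma s * defect s x <= 2 * a.
Proof.
under eq_bigr do rewrite /defect mulrDr.
rewrite big_split /= -mulr_suml (sum_center_law gs) mul1r.
have := center_bound gs x; under eq_bigr do rewrite mulrC A_sym; a_lra.
Qed.

Lemma center_mean_gt0 x : 0 < center_mean sigma x.
Proof. by have := center_mean_ge x; a_lra. Qed.

Lemma tilt_sub1 s x : `|tilt sigma s x - 1| <= 2 * defect s x.
Proof.
have c0 := center_mean_ge x; have c1 := center_mean_le1 x.
have c2 := center_mean_gt0 x.
have -> : tilt sigma s x - 1 = (A s x - center_mean sigma x) / center_mean sigma x.
  by rewrite /tilt; field; rewrite gt_eqF.
have ci : (center_mean sigma x)^-1 <= 2.
  by rewrite -[leRHS]invrK lef_pV2 ?posrE; a_lra.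
rewrite normrM mulrC ler_pM ?normr_ge0//.
  by rewrite gtr0_norm ?invr_gt0.
by rewrite ler_norml /defect; have := A_le1 s x; a_lra.
Qed.

Lemma tilt_mean_sub1 i s : E v i -> `|tilt_mean i sigma s - 1| <= 6 * a.
Proof.
move=> vi; have -> : tilt_mean i sigma s - 1 =
    \sum_x heat E A lam i sigma x * (tilt sigma s x - 1).
  under [RHS]eq_bigr do rewrite mulrBr mulr1.
  by rewrite sumrB sum_heat_leaf.
apply: le_trans (ler_norm_sum _ _ _) _.
apply: le_trans (_ : \sum_x 2 * (heat E A lam i sigma x * defect s x) <= _).
  apply: ler_sum => x _; rewrite normrM ger0_norm ?heat_ge0// mulrCA.
  by rewrite ler_wpM2l ?heat_ge0// tilt_sub1.
by rewrite -mulr_sumr; have := mean_defect s vi; a_lra.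
Qed.

Lemma tilt_mean_ge i s : E v i -> 1 / 2 <= tilt_mean i sigma s.
Proof. by move=> vi; have := tilt_mean_sub1 s vi; rewrite ler_norml => /andP[]; a_lra. Qed.

Lemma inv_tilt_mean_sub1 i s : E v i -> `|(tilt_mean i sigma s)^-1 - 1| <= 12 * a.
Proof.
move=> vi; have n1 := tilt_mean_sub1 s vi; have n2 := tilt_mean_ge s vi.
have n0 : 0 < tilt_mean i sigma s by a_lra.
have -> : (tilt_mean i sigma s)^-1 - 1 =
   (1 - tilt_mean i sigma s) * (tilt_mean i sigma s)^-1.
  by field; rewrite gt_eqF.
rewrite normrM distrC (gtr0_norm (x := _^-1)) ?invr_gt0//.
have -> : 12 * a = 6 * a * 2 by ring.
have ni : (tilt_mean i sigma s)^-1 <= 2.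
  by rewrite -[leRHS]invrK lef_pV2 ?posrE; a_lra.
by rewrite ler_pM ?normr_ge0 ?invr_ge0 ?(ltW n0).
Qed.

Lemma tilt_ratio_sub1 i s x : E v i ->
  `|tilt sigma s x / tilt_mean i sigma s - 1| <= 16 * defect s x.
Proof.
move=> vi; have t1 := tilt_sub1 s x; have n1 := inv_tilt_mean_sub1 s vi.
have -> : tilt sigma s x / tilt_mean i sigma s - 1 =
  (tilt sigma s x - 1) * ((tilt_mean i sigma s)^-1 - 1)
  + (tilt sigma s x - 1) + ((tilt_mean i sigma s)^-1 - 1) by ring.
apply: le_trans (ler_normD _ _) _; apply: le_trans (lerD (ler_normD _ _) n1) _.
have a2 : a <= defect s x by rewrite /defect; have := A_le1 s x; a_lra.
have : `|(tilt sigma s x - 1) * ((tilt_mean i sigma s)^-1 - 1)| <= 2 * defect s x * 1.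
  by rewrite normrM ler_pM// (le_trans n1)//; a_lra.
by have := defect_ge0 s x; a_lra.
Qed.

(** Cauchy-Schwarz with weight [center_law] times [defect] gains 2 a from the sum over [s];
    averaging the remaining [defect] over the leaf spin gains 3 a. Keeping the sum over [s] inside
    the square yields a^2 rather than a. *)
Lemma mean_square_le (k : R) i (H : 'I_q -> R) (y : 'I_q -> 'I_q -> R) :
  E v i -> 0 <= k -> (forall s x, `|y s x| <= k * defect s x) ->
  \sum_x heat E A lam i sigma x * (\sum_s center_law v sigma s * H s * y s x) ^+ 2 <=
  6 * k ^+ 2 * a ^+ 2 * \sum_s center_law v sigma s * H s ^+ 2.
Proof.
move=> vi k0 yk.
have m0 s : 0 <= center_law v sigma s by exact: center_law_ge0.
have cs x : (\sum_s center_law v sigma s * H s * y s x) ^+ 2 <=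
    k ^+ 2 * (2 * a) * \sum_s center_law v sigma s * H s ^+ 2 * defect s x.
  pose w s := center_law v sigma s * defect s x.
  have w0 s : 0 <= w s by rewrite mulr_ge0 ?defect_ge0.
  pose aH s : R := `|H s|; pose one (s : 'I_q) : R := 1.
  have S1 : `|\sum_s center_law v sigma s * H s * y s x| <= k * inner w aH one.
    apply: le_trans (ler_norm_sum _ _ _) _; rewrite /inner mulr_sumr.
    apply: ler_sum => s _; rewrite /w /aH /one mulr1 !normrM (ger0_norm (m0 s)).
    have -> : k * (center_law v sigma s * defect s x * `|H s|) =
              center_law v sigma s * `|H s| * (k * defect s x) by ring.
    by rewrite ler_wpM2l// mulr_ge0.
  have := bil_cauchy_schwarz _ (innerC w) (innerDl w) (innerZl w)
    (fun f => inner_ge0 w f w0) aH one.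
  have -> : inner w aH aH = \sum_s center_law v sigma s * H s ^+ 2 * defect s x.
    apply: eq_bigr => s _; rewrite /w /aH -mulrA -expr2 real_normK ?num_real//; ring.
  have : inner w one one <= 2 * a.
    by apply: le_trans (center_defect x); apply: ler_sum => s _; rewrite /one !mulr1.
  set X := \sum_s _ * _ * defect s x => I1 CS.
  have X0 : 0 <= X.
    by apply: sumr_ge0 => s _; rewrite mulr_ge0 ?defect_ge0// mulr_ge0 ?sqr_ge0.
  apply: le_trans (_ : (k * inner w aH one) ^+ 2 <= _).
    by rewrite -[leLHS]real_normK ?num_real// lerXn2r ?nnegrE ?normr_ge0// (le_trans _ S1)// normr_ge0.
  rewrite exprMn -mulrA ler_wpM2l ?sqr_ge0// (le_trans CS)// mulrC ler_wpM2r//.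
apply: le_trans (_ : \sum_x heat E A lam i sigma x *
    (k ^+ 2 * (2 * a) * \sum_s center_law v sigma s * H s ^+ 2 * defect s x) <= _).
  by apply: ler_sum => x _; rewrite ler_wpM2l ?heat_ge0.
have -> : \sum_x heat E A lam i sigma x *
    (k ^+ 2 * (2 * a) * \sum_s center_law v sigma s * H s ^+ 2 * defect s x) =
  k ^+ 2 * (2 * a) * \sum_s center_law v sigma s * H s ^+ 2 *
     \sum_x heat E A lam i sigma x * defect s x.
  rewrite [RHS]mulr_sumr; under [RHS]eq_bigr do rewrite mulr_sumr mulr_sumr.
  rewrite exchange_big; apply: eq_bigr => x _ /=.
  by rewrite !mulr_sumr; apply: eq_bigr => s _; ring.
have -> : 6 * k ^+ 2 * a ^+ 2 * \sum_s center_law v sigma s * H s ^+ 2 =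
  k ^+ 2 * (2 * a) * \sum_s center_law v sigma s * H s ^+ 2 * (3 * a).
  by rewrite -mulr_suml; ring.
rewrite ler_wpM2l ?mulr_ge0 ?sqr_ge0//; apply: ler_sum => s _.
by rewrite ler_wpM2l ?mean_defect// mulr_ge0 ?sqr_ge0.
Qed.

End GoodBounds.

Section TestFunction.
Variable h : config V q -> R.
Hypothesis h_inv : leaf_invariant v h.

Definition flow s sigma : R :=
  (good v sigma)%:R * center_law v sigma s * (h sigma - h (update sigma v s)).

(** The function F of the initial outline, for a level 0 function [h], later the level 0 part of L_v
    f. *)
Definition test_function sigma : R :=
  \sum_s flow s sigma * \prod_(i | E v i) tilt_factor s i sigma.

Lemma flow_invariant s : leaf_invariant v (flow s).
Proof.
move=> sigma i t vi; rewrite /flow good_update ?center_law_update ?leaf_cnbhd//.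
by rewrite h_inv// (updateC _ _ _ (leaf_neq vi)) h_inv.
Qed.

Lemma resample_tilt s i f sigma : E v i ->
  (forall x, f (update sigma i x) = f sigma) ->
  \sum_x heat E A lam i sigma x *
    (flow s (update sigma i x) * (f (update sigma i x) * tilt_factor s i (update sigma i x)))
  = flow s sigma * f sigma.
Proof.
move=> vi fi; under eq_bigr => x _.
  rewrite flow_invariant// fi /tilt_factor tilt_mean_update// tilt_update ?leaf_cnbhd//.
  rewrite update_same.
  have -> : heat E A lam i sigma x * (flow s sigma * (f sigma *
     (tilt sigma s x / tilt_mean i sigma s))) =
     heat E A lam i sigma x * tilt sigma s x * (flow s sigma * f sigma / tilt_mean i sigma s)
     by ring.
over.
rewrite -mulr_suml -/(tilt_mean i sigma s) /flow.
have [gs|ng] := boolP (good v sigma); last by rewrite /= !mul0r mulr0.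
by rewrite mulrC mulfVK// gt_eqF//; have := tilt_mean_ge gs s vi; a_lra.
Qed.

(** The factor of leaf [i] once the projections along [l] are applied: averaging turns a tilt factor
    into 1, taking the fluctuation subtracts 1. *)
Definition component_factor (l : seq V) (T : {set V}) s i sigma : R :=
  if i \in l then (if i \in T then tilt_factor s i sigma - 1 else 1)
  else tilt_factor s i sigma.

(** Among the leaf spins, the factor of [j] depends only on the one at [j], and [flow] on none, so
    each projection acts on a single factor. *)
Lemma partial_component_test (l : seq V) (T : {set V}) : uniq l ->
  (forall i, i \in T -> E v i) ->
  partial_component (star_fluct v) l T test_function =
  fun sigma => \sum_s flow s sigma * \prod_(i | E v i) component_factor l T s i sigma.
Proof.
move=> + TE; elim: l => [//|j l IH] /= /andP[jl /IH ->]; apply/funext => sigma.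
case vj : (E v j); last first.
  have jT : (j \in T) = false by apply/negP => /TE; rewrite vj.
  rewrite jT /star_fluct vj.
  transitivity (\sum_s flow s sigma * \prod_(i | E v i) component_factor l T s i sigma - 0) => //.
  rewrite subr0; apply: eq_bigr => s _; congr (_ * _); apply: eq_bigr => i vi.
  by rewrite /component_factor inE; case: eqP => // ij; move: vi; rewrite ij vj.
pose others l' s sigma := \prod_(i | E v i && (i != j)) component_factor l' T s i sigma.
have prodE l' s rho : \prod_(i | E v i) component_factor l' T s i rho =
    others l' s rho * component_factor l' T s j rho.
  by rewrite (bigD1 j)//= mulrC.
have resampleE : resample E A lam j (fun sigma => \sum_s flow s sigma *
    \prod_(i | E v i) component_factor l T s i sigma) sigma =
    \sum_s flow s sigma * others l s sigma.
  rewrite /resample; under eq_bigr do rewrite mulr_sumr.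
  rewrite exchange_big; apply: eq_bigr => s _ /=.
  have others_inv x : others l s (update sigma j x) = others l s sigma.
    apply: eq_bigr => i /andP[vi ij].
    by rewrite /component_factor (tilt_factor_update _ _ _ vi vj ij).
  rewrite -(resample_tilt _ vj others_inv).
  apply: eq_bigr => x _; rewrite prodE; congr (_ * (_ * (_ * _))).
  by rewrite /component_factor (negPf jl).
have othersE s : others (j :: l) s sigma = others l s sigma.
  apply: eq_bigr => i /andP[vi ij].
  by rewrite /component_factor inE (negPf ij).
rewrite /star_fluct vj; case jT : (j \in T).
  rewrite fluctE; set G := (fun _ => _) in resampleE *.
  transitivity (G sigma - resample E A lam j G sigma) => //.
  rewrite resampleE /G -sumrB; apply: eq_bigr => s _; rewrite !prodE othersE.
  by rewrite /component_factor (negPf jl) mem_head jT; ring.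
rewrite fluctE; set G := (fun _ => _) in resampleE *.
transitivity (G sigma - (G sigma - resample E A lam j G sigma)) => //.
rewrite opprB addrCA subrr addr0 resampleE; apply: eq_bigr => s _.
by rewrite prodE othersE /component_factor mem_head jT mulr1.
Qed.

Lemma component_test (T : {set V}) : (forall i, i \in T -> E v i) ->
  component (star_fluct v) T test_function =
  fun sigma => \sum_s flow s sigma * \prod_(i in T) (tilt_factor s i sigma - 1).
Proof.
move=> TE; rewrite /component partial_component_test ?enum_uniq//.
apply/funext => sigma; apply: eq_bigr => s _; congr (_ * _).
rewrite [RHS]big_mkcond [LHS]big_mkcond; apply: eq_bigr => i _.
rewrite /component_factor mem_enum /=; case: ifP => [_|vi] //.
by case: ifP => // /TE; rewrite vi.
Qed.

Lemma component_test0 (T : {set V}) i : i \in T -> ~~ E v i ->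
  component (star_fluct v) T test_function = 0.
Proof.
move=> iT vi; have := L_component _ (@star_fluct_idem v) (@star_fluctC v) i T test_function.
by rewrite iT /star_fluct (negPf vi) => <-.
Qed.

(** The products are empty, and summing [flow] over [s] subtracts from [h] its mean given the
    pinning, which is 0. *)
Lemma component_test_set0 :
  (forall sigma, \sum_s center_law v sigma s * h (update sigma v s) = 0) ->
  forall sigma, good v sigma -> component (star_fluct v) set0 test_function sigma = h sigma.
Proof.
move=> h0 sigma gs; rewrite component_test => [|i]; last by rewrite inE.
under eq_bigr do rewrite big_set0 mulr1 /flow gs mul1r mulrBr.
by rewrite sumrB -mulr_suml (sum_center_law gs) mul1r h0 subr0.
Qed.

(* The sum over [(s, s')] has a symmetric kernel [k] and an antisymmetric factor
   [H s - H s'], because [tilt_mean i] at [s] is [M i s s' / leaf_factor i s]. *)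
Lemma resample_test sigma : good v sigma -> resample E A lam v test_function sigma = 0.
Proof.
move=> gs; have [c c0 cE] := center_law_factor gs.
pose M i s s' := \sum_x leaf_law v i sigma x * A x s * A s' x / center_mean sigma x.
pose Z := \sum_t local_weight E A lam v sigma t.
pose k s s' := c / Z * (lam s 0 * lam s' 0) * \prod_(i | E v i)
  (A s (sigma i) * A s' (sigma i) / center_mean sigma (sigma i)
   * (leaf_factor v i sigma s * leaf_factor v i sigma s') / M i s s').
have kC s s' : k s s' = k s' s.
  rewrite /k (mulrC (lam s 0)); congr (_ * _); apply: eq_bigr => i _.
  rewrite (mulrC (A s _)) (mulrC (leaf_factor v i sigma s)); congr (_ / _).
  by apply: eq_bigr => x _; rewrite (A_sym x s) (A_sym s' x); ring.
pose H s := h (update sigma v s).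
have vN : v \in cnbhd E v by rewrite cnbhdE eqxx.
have -> : resample E A lam v test_function sigma = \sum_s \sum_s' k s s' * (H s - H s').
  apply: eq_bigr => s _; rewrite mulr_sumr; apply: eq_bigr => s' _.
  rewrite /flow good_update// gs mul1r center_law_update// update_update.
  rewrite -/(H s) -/(H s').
  have -> : \prod_(i | E v i) tilt_factor s' i (update sigma v s) =
    \prod_(i | E v i) (A s' (sigma i) / center_mean sigma (sigma i) *
        leaf_factor v i sigma s / M i s s').
    apply: eq_bigr => i vi; rewrite /tilt_factor tilt_update//.
    rewrite update_other ?leaf_neq// /tilt -!mulrA; congr (_ * (_ * _)).
    have gs' : good v (update sigma v s) by rewrite good_update.
    have -> : tilt_mean i (update sigma v s) s' = M i s s' / leaf_factor v i sigma s.
      rewrite /tilt_mean /M mulr_suml; apply: eq_bigr => x _.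
      rewrite (heat_leaf _ gs' vi) tilt_update// update_same /tilt leaf_law_update//.
      have -> : leaf_factor v i (update sigma v s) s = leaf_factor v i sigma s.
        by apply: eq_bigr => y _; rewrite leaf_law_update.
      by ring.
    by rewrite invf_div.
  rewrite cE /heat -/Z /k /local_weight.
  rewrite [X in _ = _ * X * _](eq_bigr (fun i => A s (sigma i) * leaf_factor v i sigma s' *
     (A s' (sigma i) / center_mean sigma (sigma i) * leaf_factor v i sigma s / M i s s'))).
    by rewrite !big_split /=; ring.
  by move=> i _; ring.
(* Exchanging [s] and [s'] changes the sign of the double sum, so adding the two versions gives
   0. *)
apply/eqP; rewrite -[_ == 0](mulrn_eq0 _ 2) mulr2n -{2}exchange_big /= -big_split.
rewrite big1// => s _; rewrite -big_split big1// => s' _ /=.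
by rewrite (kC s' s); ring.
Qed.

Lemma inner_test_resample f : inner mu test_function (resample E A lam v f) = 0.
Proof.
rewrite -resample_sym//; apply: big1 => sigma _.
have [gs|ng] := boolP (good v sigma); first by rewrite resample_test// mulr0 mul0r.
by rewrite (gibbs_good ng) !mul0r.
Qed.

Lemma mean_resample i Y :
  \sum_sigma mu sigma * resample E A lam i Y sigma = \sum_sigma mu sigma * Y sigma.
Proof.
have e f : \sum_sigma mu sigma * f sigma = inner mu (fun=> 1) f.
  by apply: eq_bigr => sigma _; rewrite mulr1.
by rewrite !e inner_resample_invariant.
Qed.

Lemma mean_le Y Z : (forall sigma, good v sigma -> Y sigma <= Z sigma) ->
  \sum_sigma mu sigma * Y sigma <= \sum_sigma mu sigma * Z sigma.
Proof.
move=> YZ; apply: ler_sum => sigma _.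
have [gs|ng] := boolP (good v sigma); first by rewrite ler_wpM2l ?YZ ?gibbs_ge0.
by rewrite (gibbs_good ng) !mul0r.
Qed.

Definition flow_energy s sigma : R :=
  (good v sigma)%:R * center_law v sigma s * (h sigma - h (update sigma v s)) ^+ 2.

Lemma flow_energy_update s i sigma t : E v i ->
  flow_energy s (update sigma i t) = flow_energy s sigma.
Proof.
move=> vi; rewrite /flow_energy good_update ?center_law_update ?leaf_cnbhd//.
by rewrite h_inv// (updateC _ _ _ (leaf_neq vi)) h_inv.
Qed.

Lemma flow_energy_ge0 s sigma : 0 <= flow_energy s sigma.
Proof.
rewrite /flow_energy; have [gs|_] := boolP (good v sigma); last by rewrite !mul0r.
by rewrite mul1r mulr_ge0 ?sqr_ge0 ?center_law_ge0.
Qed.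

Lemma mean_square_center :
  \sum_sigma mu sigma * (\sum_s center_law v sigma s * h (update sigma v s) ^+ 2) =
  inner mu h h.
Proof.
rewrite (mean_center_law (Y := fun sigma => h sigma ^+ 2)).
  by apply: eq_bigr => sigma _; rewrite expr2 mulrA.
by move=> sigma i t vi; rewrite h_inv.
Qed.

(** By (x - y)^2 <= 2 x^2 + 2 y^2, where both squares have mean |h|^2 by the tower property. *)
Lemma mean_flow_energy :
  \sum_sigma mu sigma * (\sum_s flow_energy s sigma) <= 4 * inner mu h h.
Proof.
have -> : 4 * inner mu h h = \sum_sigma mu sigma * (2 * h sigma ^+ 2 +
    2 * \sum_s center_law v sigma s * h (update sigma v s) ^+ 2).
  under eq_bigr => sigma _ do rewrite mulrDr (mulrCA (mu sigma)) (mulrCA _ 2).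
  rewrite big_split /= -!mulr_sumr mean_square_center.
  have -> : \sum_sigma mu sigma * h sigma ^+ 2 = inner mu h h.
    by apply: eq_bigr => sigma _; rewrite expr2 mulrA.
  by ring.
apply: mean_le => sigma gs; have m1 := sum_center_law gs.
rewrite -[X in X + _]mulr1 -m1 !mulr_sumr -big_split /=; apply: ler_sum => s _.
rewrite /flow_energy gs mul1r.
have m0 := center_law_ge0 gs s; have := mulr_ge0 m0 (sqr_ge0 (h sigma + h (update sigma v s))).
by rewrite !expr2; nra.
Qed.

Lemma mean_tilt_square s i sigma : good v sigma -> E v i ->
  \sum_x heat E A lam i sigma x * (tilt sigma s x / tilt_mean i sigma s - 1) ^+ 2
  <= 1536 * a.
Proof.
move=> gs vi.
(* The bound 256 defect^2 <= 512 defect uses defect <= 2; the mean of defect is at most 3 a. *)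
apply: le_trans (_ : \sum_x 512 * (heat E A lam i sigma x * defect s x) <= _).
  apply: ler_sum => x _; rewrite [leRHS]mulrCA ler_wpM2l ?heat_ge0//.
  rewrite -[leLHS]real_normK ?num_real//.
  apply: le_trans (_ : (16 * defect s x) ^+ 2 <= _).
    by rewrite lerXn2r ?nnegrE ?tilt_ratio_sub1// mulr_ge0 ?defect_ge0.
  have := defect_ge0 s x; have := defect_le2 s x; nra.
by rewrite -mulr_sumr; have := mean_defect gs s vi; a_lra.
Qed.

Let coef_ge0 : 0 <= 1536 * a.
Proof. exact: (mulr_ge0 (ler0n _ 1536) a_ge0). Qed.

(** Average over the leaves of T one after another: resampling a leaf affects only its own factor
    and contributes at most 1536 a. *)
Lemma tilt_moment s (T : {set V}) : (forall i, i \in T -> E v i) ->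
  \sum_sigma mu sigma * (flow_energy s sigma * \prod_(i in T) (tilt_factor s i sigma - 1) ^+ 2)
  <= (1536 * a) ^+ #|T| * \sum_sigma mu sigma * flow_energy s sigma.
Proof.
move En : #|T| => n; elim: n T En => [T /cards0_eq ->|n IH T Tn] TE.
  by rewrite expr0 mul1r; under eq_bigr do rewrite big_set0 mulr1.
have [i iT] : exists i, i \in T by apply/card_gt0P; rewrite Tn.
have vi := TE i iT.
have Tn' : #|T :\ i| = n by have := cardsD1 i T; rewrite iT Tn add1n => -[].
have TE' j : j \in T :\ i -> E v j by rewrite !inE => /andP[_ /TE].
rewrite exprS -mulrA; apply: le_trans (ler_wpM2l _ (IH _ Tn' TE')); last first.
  exact: coef_ge0.
rewrite -[leLHS](mean_resample i) mulr_sumr.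
under [leRHS]eq_bigr => sigma _ do rewrite mulrCA.
apply: mean_le => sigma gs; rewrite /resample.
pose P := \prod_(j in T :\ i) (tilt_factor s j sigma - 1) ^+ 2.
have e x : heat E A lam i sigma x * (flow_energy s (update sigma i x) *
    \prod_(j in T) (tilt_factor s j (update sigma i x) - 1) ^+ 2) =
    heat E A lam i sigma x * (tilt sigma s x / tilt_mean i sigma s - 1) ^+ 2 *
      (flow_energy s sigma * P).
  rewrite (flow_energy_update _ _ _ vi) (big_setD1 i iT) /=.
  rewrite {1}/tilt_factor (tilt_update _ _ _ _ (leaf_cnbhd vi)).
  rewrite (tilt_mean_update _ _ _ vi vi) update_same.
  rewrite (eq_bigr (fun j => (tilt_factor s j sigma - 1) ^+ 2)) -/P; last first.
    by move=> j; rewrite !inE => /andP[ji /TE vj]; rewrite tilt_factor_update.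
  by ring.
rewrite (eq_bigr _ (fun x _ => e x)).
rewrite -mulr_suml; apply: ler_wpM2r; last exact: mean_tilt_square.
by rewrite mulr_ge0 ?flow_energy_ge0// prodr_ge0// => j _; rewrite sqr_ge0.
Qed.

(** One leaf is averaged by [mean_square_le] while the sum over [s] is still inside the square,
    giving 1536 a^2; the others give 1536 a each by [tilt_moment]. This gains one power of a over
    treating all leaves alike. *)
Lemma component_test_norm (T : {set V}) : (0 < #|T|)%N ->
  inner mu (component (star_fluct v) T test_function)
           (component (star_fluct v) T test_function) <=
  (if T \subset nbhd E v then a * (1536 * a) ^+ #|T| else 0) * (4 * inner mu h h).
Proof.
move=> T0; case: ifP => [/subsetP TN|/negbT/subsetPn[i iT]]; last first.
  rewrite inE => /(component_test0 iT) ->.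
  by rewrite (bil0l _ (innerZl mu)) mul0r.
have TE j : j \in T -> E v j by move/TN; rewrite inE.
have [i iT] : exists i, i \in T by apply/card_gt0P.
have vi := TE i iT.
have TE' j : j \in T :\ i -> E v j by rewrite !inE => /andP[_ /TE].
rewrite component_test//.
have -> : inner mu (fun sigma => \sum_s flow s sigma * \prod_(j in T) (tilt_factor s j sigma - 1))
  (fun sigma => \sum_s flow s sigma * \prod_(j in T) (tilt_factor s j sigma - 1)) =
  \sum_sigma mu sigma * (\sum_s flow s sigma * \prod_(j in T) (tilt_factor s j sigma - 1)) ^+ 2.
  by apply: eq_bigr => sigma _; rewrite expr2 mulrA.
rewrite -(mean_resample i).
apply: le_trans (_ : \sum_sigma mu sigma * (1536 * a ^+ 2 * \sum_s flow_energy s sigma *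
    \prod_(j in T :\ i) (tilt_factor s j sigma - 1) ^+ 2) <= _).
  apply: mean_le => sigma gs; rewrite /resample.
  pose H s := (h sigma - h (update sigma v s)) * \prod_(j in T :\ i) (tilt_factor s j sigma - 1).
  pose y s x := tilt sigma s x / tilt_mean i sigma s - 1.
  have := @mean_square_le sigma gs 16 i H y vi (ler0n _ _) (fun s x => tilt_ratio_sub1 gs s x vi).
  have -> : 6 * 16 ^+ 2 * a ^+ 2 * (\sum_s center_law v sigma s * H s ^+ 2) =
     1536 * a ^+ 2 * \sum_s flow_energy s sigma *
       \prod_(j in T :\ i) (tilt_factor s j sigma - 1) ^+ 2.
    congr (_ * _); first by ring.
    apply: eq_bigr => s _; rewrite /H exprMn -prodrXl /flow_energy gs mul1r; ring.
  apply: le_trans; rewrite le_eqVlt; apply/orP; left; apply/eqP.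
  apply: eq_bigr => x _; congr (_ * _ ^+ 2); apply: eq_bigr => s _.
  rewrite flow_invariant// (big_setD1 i)//= {1}/tilt_factor tilt_update ?leaf_cnbhd//.
  rewrite (tilt_mean_update _ _ _ vi vi) update_same -/(y s x).
  rewrite (eq_bigr (fun j => tilt_factor s j sigma - 1)); last first.
    by move=> j; rewrite !inE => /andP[ji /TE vj]; rewrite tilt_factor_update.
  by rewrite /flow gs mul1r /H; ring.
have -> : \sum_sigma mu sigma * (1536 * a ^+ 2 * \sum_s flow_energy s sigma *
    \prod_(j in T :\ i) (tilt_factor s j sigma - 1) ^+ 2) =
  1536 * a ^+ 2 * \sum_s \sum_sigma mu sigma * (flow_energy s sigma *
    \prod_(j in T :\ i) (tilt_factor s j sigma - 1) ^+ 2).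
  rewrite exchange_big mulr_sumr; apply: eq_bigr => sigma _ /=.
  by rewrite mulrCA mulr_sumr.
apply: le_trans (_ : 1536 * a ^+ 2 * ((1536 * a) ^+ #|T :\ i| *
   \sum_sigma mu sigma * (\sum_s flow_energy s sigma)) <= _).
  rewrite ler_wpM2l ?mulr_ge0 ?sqr_ge0 ?ler0n//.
  have -> : \sum_sigma mu sigma * (\sum_s flow_energy s sigma) =
      \sum_s \sum_sigma mu sigma * flow_energy s sigma.
    by rewrite exchange_big; apply: eq_bigr => sigma _; rewrite mulr_sumr.
  by rewrite mulr_sumr; apply: ler_sum => s _; apply: (tilt_moment s TE').
have := cardsD1 i T; rewrite iT add1n => ->; rewrite [in leRHS]exprS.
have -> : a * (1536 * a * (1536 * a) ^+ #|T :\ i|) * (4 * inner mu h h) =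
  1536 * a ^+ 2 * ((1536 * a) ^+ #|T :\ i| * (4 * inner mu h h)) by ring.
by rewrite ler_wpM2l ?mulr_ge0 ?sqr_ge0 ?ler0n// ler_wpM2l ?exprn_ge0 ?coef_ge0// mean_flow_energy.
Qed.

(** Summing (1536 a)^|T| over the subsets of N(v) gives (1 + 1536 a)^deg, at most exp(1536 alpha);
    the spare factor a makes the total small. *)
Lemma component_test_norm_ge2 (alpha : R) : #|nbhd E v|%:R * a <= alpha ->
  \sum_(T : {set V} | (1 < #|T|)%N)
    inner mu (component (star_fluct v) T test_function)
             (component (star_fluct v) T test_function) <=
  4 * a * expR (1536 * alpha) * inner mu h h.
Proof.
move=> dega; have hh0 : 0 <= inner mu h h by apply: inner_ge0 => *; apply: gibbs_ge0.
pose G (T : {set V}) : R := if T \subset nbhd E v then (1536 * a) ^+ #|T| else 0.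
have G0 T : 0 <= G T by rewrite /G; case: ifP => _; rewrite ?exprn_ge0 ?coef_ge0.
apply: le_trans (_ : \sum_(T : {set V}) a * G T * (4 * inner mu h h) <= _).
  rewrite [leRHS](bigID (fun T : {set V} => (1 < #|T|)%N)) /= -[leLHS]addr0 lerD//.
    apply: ler_sum => T T1; apply: le_trans (component_test_norm (ltnW T1)) _.
    by rewrite /G; case: ifP; rewrite ?mulr0.
  by apply: sumr_ge0 => T _; rewrite !mulr_ge0.
rewrite -mulr_suml -mulr_sumr.
have -> : \sum_T G T = (1 + 1536 * a) ^+ #|nbhd E v|.
  rewrite -prodr_const [RHS]big_mkcond /=.
  have -> : \prod_i (if i \in nbhd E v then 1 + 1536 * a else 1) =
     \prod_i ((if i \in nbhd E v then 1536 * a else 0) + 1) :> R.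
    by apply: eq_bigr => i _; case: ifP => _; rewrite ?add0r// addrC.
  rewrite bigA_distr; apply: eq_bigr => T _; rewrite /G.
  rewrite -big_mkcond /=; case: ifP => [/subsetP TN|/negbT/subsetPn[i iT iN]].
    by rewrite -prodr_const; apply: eq_bigr => i /TN ->.
  by rewrite (bigD1 i)//= (negPf iN) mul0r.
have -> : 4 * a * expR (1536 * alpha) * inner mu h h =
  a * expR (1536 * alpha) * (4 * inner mu h h) by ring.
rewrite ler_wpM2r ?mulr_ge0// ler_wpM2l//.
apply: le_trans (_ : expR (1536 * a) ^+ #|nbhd E v| <= _).
  by rewrite lerXn2r ?nnegrE ?expR_ge0 ?addr_ge0 ?coef_ge0 ?ler01// expR_ge1Dx.
by rewrite -expRM_natl ler_expR mulrCA ler_wpM2l ?ler0n.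
Qed.

Section FirstLevel.
Variables (kappa delta alpha : R).
Hypothesis delta_gt0 : 0 < delta.
Hypothesis dega : #|nbhd E v|%:R * a <= alpha.
Hypothesis h0 : forall sigma, \sum_s center_law v sigma s * h (update sigma v s) = 0.
Hypothesis spectral : forall sigma, good v sigma -> forall g : 'I_q -> R,
  \sum_x (\sum_(i | E v i) leaf_law v i sigma x) *
     (\sum_s (1 - A x s) * center_law v sigma s * g s) ^+ 2 <=
  kappa * \sum_s center_law v sigma s * g s ^+ 2.

(** The first-level component at a leaf with spin [x], with [tilt_mean] replaced by 1. *)
Let X sigma x := \sum_s center_law v sigma s * (h sigma - h (update sigma v s)) *
  (tilt sigma s x - 1).

(* The choice of [tilt] makes the coefficient of [h sigma] vanish exactly. *)
Let XE sigma x : good v sigma -> X sigma x =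
  (\sum_s (1 - A x s) * center_law v sigma s * h (update sigma v s)) / center_mean sigma x.
Proof.
move=> gs; have c0 := center_mean_gt0 gs x.
have -> : X sigma x = h sigma * (\sum_s center_law v sigma s * tilt sigma s x
   - \sum_s center_law v sigma s)
   - ((\sum_s center_law v sigma s * h (update sigma v s) * A x s) / center_mean sigma x
      - \sum_s center_law v sigma s * h (update sigma v s)).
  rewrite mulr_suml -!sumrB mulr_sumr -sumrB; apply: eq_bigr => s _.
  by rewrite /tilt (A_sym x s); ring.
have -> : \sum_s center_law v sigma s * tilt sigma s x = 1.
  rewrite -[RHS](divff (lt0r_neq0 c0)) {2}/center_mean mulr_suml; apply: eq_bigr => s _.
  by rewrite /tilt (A_sym x s) mulrA.
rewrite (sum_center_law gs) subrr mulr0 h0 subr0 sub0r.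
have -> : \sum_s (1 - A x s) * center_law v sigma s * h (update sigma v s) =
  \sum_s center_law v sigma s * h (update sigma v s) -
  \sum_s center_law v sigma s * h (update sigma v s) * A x s.
  by rewrite -sumrB; apply: eq_bigr => s _; ring.
by rewrite h0 sub0r mulNr.
Qed.

(** The spectral bound is applied to s -> h(sigma^(v -> s)). The three powers of 1 - a come from
    comparing the heat-bath law with [leaf_law] and from the square of [center_mean]. *)
Let sum_X sigma : good v sigma ->
  \sum_(i | E v i) \sum_x heat E A lam i sigma x * X sigma x ^+ 2 <=
  kappa / (1 - a) ^+ 3 * \sum_s center_law v sigma s * h (update sigma v s) ^+ 2.
Proof.
move=> gs; have a1 : 0 < 1 - a by a_lra.
apply: le_trans (_ : \sum_(i | E v i) \sum_x (leaf_law v i sigma x / (1 - a)) *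
   ((\sum_s (1 - A x s) * center_law v sigma s * h (update sigma v s)) ^+ 2 / (1 - a) ^+ 2) <= _).
  apply: ler_sum => i vi; apply: ler_sum => x _; rewrite ler_pM ?heat_ge0 ?sqr_ge0 ?heat_le//.
  rewrite XE// expr_div_n ler_wpM2l ?sqr_ge0//.
  have c0 := center_mean_gt0 gs x.
  rewrite lef_pV2 ?posrE ?exprn_gt0// lerXn2r ?nnegrE ?center_mean_ge ?ltW//.
rewrite exchange_big /=.
have -> : \sum_x \sum_(i | E v i) (leaf_law v i sigma x / (1 - a)) *
   ((\sum_s (1 - A x s) * center_law v sigma s * h (update sigma v s)) ^+ 2 / (1 - a) ^+ 2) =
  (\sum_x (\sum_(i | E v i) leaf_law v i sigma x) *
     (\sum_s (1 - A x s) * center_law v sigma s * h (update sigma v s)) ^+ 2) / (1 - a) ^+ 3.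
  rewrite mulr_suml; apply: eq_bigr => x _; rewrite -!mulr_suml.
  by field; rewrite gt_eqF.
rewrite [leRHS]mulrAC ler_wpM2r ?invr_ge0 ?exprn_ge0 ?(ltW a1)//.
exact: (spectral gs (fun s => h (update sigma v s))).
Qed.

Let variance_split i sigma : good v sigma -> E v i ->
  \sum_x heat E A lam i sigma x * (\sum_s center_law v sigma s *
     (h sigma - h (update sigma v s)) * (tilt sigma s x / tilt_mean i sigma s - 1)) ^+ 2 <=
  (1 + delta) * (\sum_x heat E A lam i sigma x * X sigma x ^+ 2) +
  (1 + delta^-1) * (3456 * a ^+ 4 * \sum_s flow_energy s sigma).
Proof.
move=> gs vi.
pose H s := h sigma - h (update sigma v s).
pose y s x := (tilt sigma s x - 1) * ((tilt_mean i sigma s)^-1 - 1).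
pose Y x := \sum_s center_law v sigma s * H s * y s x.
pose z := \sum_s center_law v sigma s * H s * ((tilt_mean i sigma s)^-1 - 1).
pose f x := \sum_s center_law v sigma s * H s * (tilt sigma s x / tilt_mean i sigma s - 1).
have fE x : f x = X sigma x + Y x + z.
  rewrite /f /X /Y /z -!big_split; apply: eq_bigr => s _; rewrite /y /H /=; ring.
have f0 : \sum_x heat E A lam i sigma x * f x = 0.
  under eq_bigr do rewrite mulr_sumr.
  rewrite exchange_big big1// => s _ /=.
  have -> : \sum_x heat E A lam i sigma x * (center_law v sigma s * H s *
      (tilt sigma s x / tilt_mean i sigma s - 1)) = center_law v sigma s * H s *
     (tilt_mean i sigma s / tilt_mean i sigma s - \sum_x heat E A lam i sigma x).
    rewrite mulr_suml -sumrB mulr_sumr; apply: eq_bigr => x _; ring.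
  rewrite (sum_heat_leaf gs vi) divff ?subrr ?mulr0// gt_eqF//.
  by have := tilt_mean_ge gs s vi; lra.
have Ybound : \sum_x heat E A lam i sigma x * Y x ^+ 2 <=
    3456 * a ^+ 4 * \sum_s flow_energy s sigma.
  have k0 : 0 <= 24 * a by rewrite mulr_ge0 ?ler0n.
  have yk s x : `|y s x| <= 24 * a * defect s x.
    have -> : 24 * a * defect s x = 2 * defect s x * (12 * a) by ring.
    by rewrite normrM ler_pM ?tilt_sub1 ?inv_tilt_mean_sub1.
  have := mean_square_le gs H vi k0 yk.
  have -> : 6 * (24 * a) ^+ 2 * a ^+ 2 = 3456 * a ^+ 4 by ring.
  by under [X in _ -> _ <= _ * X]eq_bigr do rewrite /flow_energy gs mul1r.
apply: le_trans (lerD (lexx _) (ler_wpM2l _ Ybound)); last first.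
  by rewrite addr_ge0// invr_ge0 ltW.
have -> : \sum_x heat E A lam i sigma x * f x ^+ 2 =
   \sum_x heat E A lam i sigma x * (X sigma x + Y x) ^+ 2 - z ^+ 2.
  have p1 := sum_heat_leaf gs vi.
  have -> : z ^+ 2 = (\sum_x heat E A lam i sigma x) * z ^+ 2
     - 2 * z * \sum_x heat E A lam i sigma x * f x by rewrite p1 f0; ring.
  rewrite mulr_suml mulr_sumr -!sumrB; apply: eq_bigr => x _; rewrite fE; ring.
apply: le_trans (_ : \sum_x heat E A lam i sigma x * (X sigma x + Y x) ^+ 2 <= _).
  by rewrite gerBl sqr_ge0.
rewrite !mulr_sumr -big_split; apply: ler_sum => x _ /=.
rewrite !(mulrCA _ (heat _ _ _ _ _ _)) -mulrDr ler_wpM2l ?heat_ge0//.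
have d0 : delta != 0 by rewrite gt_eqF.
have -> : (1 + delta) * X sigma x ^+ 2 + (1 + delta^-1) * Y x ^+ 2 =
  (X sigma x + Y x) ^+ 2 + (delta * X sigma x - Y x) ^+ 2 / delta by field.
by rewrite lerDl mulr_ge0 ?sqr_ge0// invr_ge0 ltW.
Qed.

(** Summed over the leaves, the error a^4 becomes alpha a^3 because deg a <= alpha; 13824 is 4 times
    3456, by [mean_flow_energy]. *)
Lemma component_test_norm1 :
  \sum_(T : {set V} | #|T| == 1%N)
    inner mu (component (star_fluct v) T test_function)
             (component (star_fluct v) T test_function) <=
  ((1 + delta) * (kappa / (1 - a) ^+ 3) + (1 + delta^-1) * (13824 * alpha * a ^+ 3))
   * inner mu h h.
Proof.
rewrite sum_card1 (bigID (E v)) /= [X in _ + X]big1 ?addr0; last first.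
  move=> i vi; rewrite (component_test0 (i := i)) ?set11//.
  by rewrite (bil0l _ (innerZl mu)).
have step i : E v i ->
    inner mu (component (star_fluct v) [set i] test_function)
             (component (star_fluct v) [set i] test_function) =
    \sum_sigma mu sigma * (resample E A lam i (fun sigma => (\sum_s flow s sigma *
       (tilt_factor s i sigma - 1)) ^+ 2)) sigma.
  move=> vi; rewrite mean_resample component_test => [|j]; last by rewrite inE => /eqP ->.
  by apply: eq_bigr => sigma _; rewrite -mulrA -expr2; under eq_bigr do rewrite big_set1.
rewrite (eq_bigr _ step) exchange_big /=.
under eq_bigr do rewrite -mulr_sumr.
apply: le_trans (_ : \sum_sigma mu sigma * ((1 + delta) * (kappa / (1 - a) ^+ 3 *
   \sum_s center_law v sigma s * h (update sigma v s) ^+ 2) +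
   (1 + delta^-1) * (3456 * alpha * a ^+ 3 * \sum_s flow_energy s sigma)) <= _).
  apply: mean_le => sigma gs.
  apply: le_trans (_ : \sum_(i | E v i)
    ((1 + delta) * (\sum_x heat E A lam i sigma x * X sigma x ^+ 2) +
    (1 + delta^-1) * (3456 * a ^+ 4 * \sum_s flow_energy s sigma)) <= _).
    apply: ler_sum => i vi; apply: le_trans (variance_split gs vi).
    rewrite le_eqVlt; apply/orP; left; apply/eqP; apply: eq_bigr => x _.
    congr (_ * _ ^+ 2); apply: eq_bigr => s _.
    rewrite (flow_invariant _ _ _ vi) /tilt_factor (tilt_update _ _ _ _ (leaf_cnbhd vi)).
    by rewrite (tilt_mean_update _ _ _ vi vi) update_same /flow gs mul1r.
  rewrite big_split /= -mulr_sumr lerD//.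
    by rewrite ler_wpM2l ?sum_X// addr_ge0// ltW.
  have -> : \sum_(i | E v i) (1 + delta^-1) * (3456 * a ^+ 4 * \sum_s flow_energy s sigma)
     = #|nbhd E v|%:R * ((1 + delta^-1) * (3456 * a ^+ 4 * \sum_s flow_energy s sigma)).
    by rewrite sumr_const [RHS]mulr_natl; congr (_ *+ _); apply: eq_card => i; rewrite inE.
  have -> : #|nbhd E v|%:R * ((1 + delta^-1) * (3456 * a ^+ 4 * \sum_s flow_energy s sigma)) =
    (1 + delta^-1) * (#|nbhd E v|%:R * a * (3456 * a ^+ 3 * \sum_s flow_energy s sigma)) by ring.
  have -> : (1 + delta^-1) * (3456 * alpha * a ^+ 3 * \sum_s flow_energy s sigma) =
    (1 + delta^-1) * (alpha * (3456 * a ^+ 3 * \sum_s flow_energy s sigma)) by ring.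
  apply: ler_wpM2l; first by rewrite addr_ge0 ?ler01 ?invr_ge0 ?(ltW delta_gt0).
  apply: ler_wpM2r dega; apply: mulr_ge0.
    exact: (mulr_ge0 (ler0n _ _) (exprn_ge0 _ a_ge0)).
  by apply: sumr_ge0 => s _; apply: flow_energy_ge0.
under eq_bigr do rewrite mulrDr !(mulrCA (mu _)).
rewrite big_split /= -!mulr_sumr mean_square_center [leRHS]mulrDl -!mulrA.
apply: lerD; first exact: lexx.
apply: ler_wpM2l; first by rewrite addr_ge0 ?ler01 ?invr_ge0 ?(ltW delta_gt0).
have al0 : 0 <= alpha by apply: le_trans dega; rewrite mulr_ge0.
have c0 : 0 <= 3456 * (alpha * a ^+ 3).
  exact: (mulr_ge0 (ler0n _ _) (mulr_ge0 al0 (exprn_ge0 _ a_ge0))).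
by have := ler_wpM2l c0 mean_flow_energy; congr (_ <= _); ring.
Qed.

End FirstLevel.

End TestFunction.

End Contraction.
End Star.

(** * Summing over the stars of a graph of girth five *)

Section Girth.
Context {R : realType} {V : finType} (E : rel V).
Hypothesis E_simple : simple_graph E.
Hypothesis girth5 : (5%:R%:E <= girth R E)%E.

Lemma girth_cycle c : graph_cycle E c -> (5 <= size c)%N.
Proof.
move=> cE; have /ereal_infP/(_ ((size c)%:R)%:E) := girth5.
have -> : (5%:R%:E <= ((size c)%:R : R)%:E)%E = (5 <= size c)%N by rewrite lee_fin ler_nat.
by apply; exists c.
Qed.

Lemma girth_triangle x y z : E x y -> E y z -> ~~ E x z.
Proof.
have [Es Ei] := E_simple; move=> xy yz; apply/negP => xz.
have ne u w : E u w -> u != w by apply: contraTneq => ->; rewrite Ei.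
suff : (5 <= size [:: x; y; z])%N by [].
apply: girth_cycle; split => //; rewrite /ucycle /= xy yz (Es z x) xz.
by rewrite !inE negb_or !ne.
Qed.

Lemma girth_square u w x y : u != w -> E u x -> E w x -> E u y -> E w y -> x = y.
Proof.
have [Es Ei] := E_simple; move=> uw ux wx uy wy; apply/eqP; apply/negPn/negP => xy.
have ne a b : E a b -> a != b by apply: contraTneq => ->; rewrite Ei.
suff : (5 <= size [:: u; x; w; y])%N by [].
apply: girth_cycle; split => //; rewrite /ucycle /= ux (Es x w) wx wy (Es y u) uy.
by rewrite !inE !negb_or uw xy !ne// Es.
Qed.

End Girth.

Section GlobalBochner.
Context {R : realType} {V : finType} (E : rel V) {q : nat} (A : 'M[R]_q)
  (lam : 'cV[R]_q).
Hypothesis E_sym : symmetric E.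
Hypothesis E_irr : irreflexive E.
Hypothesis A_sym : forall s t, A s t = A t s.
Hypothesis A_ge0 : forall s t, 0 <= A s t.
Hypothesis lam_ge0 : forall s, 0 <= lam s 0.
Hypothesis E_triangle : forall x y z, E x y -> E y z -> ~~ E x z.
Hypothesis E_square : forall u w x y,
  u != w -> E u x -> E w x -> E u y -> E w y -> x = y.
Variables (D : R) (f : config V q -> R).
Hypothesis D_gt0 : 0 < D.
Hypothesis deg_le : forall v, #|nbhd E v|%:R <= D.

Local Notation mu := (gibbs A lam E).
Local Notation L := (fluct E A lam).
Local Notation Ls := (star_fluct E A lam).

(** Count how often each ordered pair of vertices occurs on the left. An adjacent pair occurs once,
    as centre and leaf, and never as two leaves, which would close a triangle. A nonadjacent pair
    has at most one common neighbour, so it occurs at most once, and its term is nonnegative. On the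
    diagonal, one half comes from the centre and at most one half from the at most D neighbours. *)
Lemma star_sum :
  \sum_v (1 / 2 * inner mu (L v f) (L v f) + \sum_i inner mu (L v f) (Ls v i f)
     + \sum_i \sum_(j | j != i) inner mu (Ls v i f) (Ls v j f)
     + (2 * D)^-1 * \sum_i inner mu (Ls v i f) (Ls v i f)) <=
  inner mu (\sum_v L v f) (\sum_v L v f).
Proof.
pose c u w := inner mu (L u f) (L w f).
have c_ge0 u : 0 <= c u u by apply: inner_ge0 => x; apply: gibbs_ge0.
have LsE v i g : inner mu g (Ls v i f) = (E v i)%:R * inner mu g (L i f).
  rewrite /star_fluct; case: ifP => _; first by rewrite mul1r.
  by rewrite mul0r (bil0r _ (innerC mu) (innerZl mu)).
have LsE2 v i j : inner mu (Ls v i f) (Ls v j f) = ((E v i) && (E v j))%:R * c i j.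
  rewrite LsE innerC LsE innerC mulrA -natrM mulnb andbC //.
rewrite [leRHS](_ : _ = \sum_i \sum_j c i j); last first.
  rewrite (bil_suml _ (innerDl mu) (innerZl mu)); apply: eq_bigr => i _.
  by rewrite (bil_sumr _ (innerC mu) (innerDl mu) (innerZl mu)).
rewrite !big_split /=.
have e1 : \sum_v 1 / 2 * inner mu (L v f) (L v f) = 1 / 2 * \sum_v c v v.
  by rewrite mulr_sumr.
have e2 : \sum_v \sum_i inner mu (L v f) (Ls v i f) = \sum_i \sum_j (E i j)%:R * c i j.
  by apply: eq_bigr => v _; apply: eq_bigr => i _; rewrite LsE.
pose cn i j : R := \sum_v ((E v i) && (E v j))%:R.
have e3 : \sum_v \sum_i \sum_(j | j != i) inner mu (Ls v i f) (Ls v j f) =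
    \sum_i \sum_(j | j != i) cn i j * c i j.
  rewrite exchange_big; apply: eq_bigr => i _; rewrite exchange_big.
  by apply: eq_bigr => j _; rewrite mulr_suml; apply: eq_bigr => v _; rewrite LsE2.
have e4 : \sum_v (2 * D)^-1 * (\sum_i inner mu (Ls v i f) (Ls v i f)) <=
    1 / 2 * \sum_i c i i.
  rewrite -mulr_sumr exchange_big /=.
  have -> : 1 / 2 * \sum_i c i i = (2 * D)^-1 * \sum_i D * c i i.
    by rewrite -mulr_sumr; field; rewrite gt_eqF.
  rewrite ler_wpM2l ?invr_ge0 ?mulr_ge0 ?(ltW D_gt0)//; apply: ler_sum => i _.
  under eq_bigr do rewrite LsE2 andbb.
  rewrite -mulr_suml ler_wpM2r//; apply: le_trans (deg_le i).
  rewrite -sum1_card natr_sum [leRHS]big_mkcond /=; apply: ler_sum => v _.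
  by rewrite inE E_sym; case: (E i v).
rewrite e1 e2 e3.
have e5 : \sum_i \sum_j (E i j)%:R * c i j + \sum_i \sum_(j | j != i) cn i j * c i j
   + \sum_i c i i <= \sum_i \sum_j c i j.
  rewrite -!big_split /=; apply: ler_sum => i _.
  rewrite (bigD1 i)//= E_irr mul0r add0r [leRHS](bigD1 i)//= [leRHS]addrC lerD2r.
  rewrite -big_split; apply: ler_sum => j ji /=.
  case ij : (E i j); rewrite ?mul1r ?mul0r ?add0r.
    rewrite gerDl /cn big1 ?mul0r// => v _.
    case vi : (E v i) => //=; case vj : (E v j) => //.
    by have := E_triangle vi ij; rewrite vj.
  rewrite ler_piMl//; first by apply: fluct_commute_ge0; rewrite ?ij.
  have [v vij|cn0] := pickP (fun v => E v i && E v j); last first.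
    by rewrite /cn big1// => v _; rewrite cn0.
  rewrite /cn (bigD1 v)//= vij big1 ?addr0// => w wv.
  case wij : (E w i && E w j) => //; case/andP: vij => vi vj; case/andP: wij => wi wj.
  by move: ji; rewrite (E_square wv wi vi wj vj) eqxx.
by lra.
Qed.

End GlobalBochner.

(** * Operator norm and numerical constants *)

Section OperatorNorm.
Context {R : realType} {q : nat}.
Implicit Types (M : 'M[R]_q) (x : 'cV[R]_q).

Lemma euclid_norm_ge0 x : 0 <= euclid_norm x.
Proof. exact: sqrtr_ge0. Qed.

Lemma sqr_euclid_norm x : euclid_norm x ^+ 2 = \sum_s x s 0 ^+ 2.
Proof. by rewrite sqr_sqrtr// sumr_ge0// => *; rewrite sqr_ge0. Qed.

Lemma euclid_normZ k x : euclid_norm (k *: x) = `|k| * euclid_norm x.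
Proof.
rewrite -sqrtr_sqr -sqrtrM ?sqr_ge0//; congr Num.sqrt.
by rewrite mulr_sumr; apply: eq_bigr => s _; rewrite mxE exprMn.
Qed.

Lemma euclid_norm_eq0 x : euclid_norm x = 0 -> x = 0.
Proof.
move=> x0; have /eqP := sqr_euclid_norm x; rewrite x0 expr0n /= eq_sym psumr_eq0 => [|*]; last exact: sqr_ge0.
move/allP => H; apply/colP => s; rewrite mxE; apply/eqP.
by have := H s (mem_index_enum _); rewrite sqrf_eq0.
Qed.

Lemma op_norm_le M x : euclid_norm (M *m x) <= op_norm M * euclid_norm x.
Proof.
have unit_le y : euclid_norm y <= 1 -> euclid_norm (M *m y) <= op_norm M.
  move=> y1; apply: ub_le_sup; last by exists y.
  (* Boundedness makes the supremum an upper bound; vectors of norm at most 1 have coordinates at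
     most 1 in absolute value, whence this crude bound. *)
  exists (Num.sqrt (\sum_t (\sum_s `|M t s|) ^+ 2)) => _ [z /= z1 <-].
  rewrite /euclid_norm ler_wsqrtr//; apply: ler_sum => t _.
  rewrite -[leLHS]real_normK ?num_real// lerXn2r ?nnegrE ?sumr_ge0// mxE.
  apply: le_trans (ler_norm_sum _ _ _) _; apply: ler_sum => s _.
  rewrite normrM ler_piMr//.
  rewrite -(@expr_le1 _ 2)// real_normK ?num_real//.
  apply: le_trans (_ : euclid_norm z ^+ 2 <= 1); last by rewrite expr_le1// euclid_norm_ge0.
  by rewrite sqr_euclid_norm (bigD1 s)//= lerDl sumr_ge0// => *; rewrite sqr_ge0.
have [x0|x0] := eqVneq (euclid_norm x) 0.
  rewrite x0 mulr0 (euclid_norm_eq0 x0) mulmx0 /euclid_norm big1 ?sqrtr0// => s _.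
  by rewrite mxE expr0n.
have {}x0 : 0 < euclid_norm x by rewrite lt_neqAle eq_sym x0 euclid_norm_ge0.
have := unit_le ((euclid_norm x)^-1 *: x).
rewrite -scalemxAr !euclid_normZ ger0_norm ?invr_ge0 ?euclid_norm_ge0//.
rewrite mulVf ?gt_eqF// => /(_ (lexx _)).
by rewrite mulrC ler_pdivrMr.
Qed.

End OperatorNorm.

Lemma mx_entry_le_norm (R : realType) (m n : nat) (M : 'M[R]_(m, n)) i j :
  M i j <= `|M|.
Proof.
apply: le_trans (ler_norm _) _.
rewrite -[leRHS]/(mx_norm M) mx_normrE.
by apply/bigmax_geP; right => /=; exists (i, j).
Qed.

Lemma diag_sqrt_mul (R : realType) (q : nat) (d x : 'cV[R]_q) s :
  (diag_sqrt d *m x) s 0 = Num.sqrt (d s 0) * x s 0.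
Proof. by rewrite /diag_sqrt mul_diag_mx !mxE. Qed.

(** The main term is at most 1 - 7/10 eps, the second at most eps / 100, the third at most 8 eps /
    10^4, and the last is eps / 4. [X] stands for the exponential and [N] for 8 times 13824, as
    variables that keep large numerals away from the arithmetic tactics. *)
Lemma gap_constants (R : realType) (alpha eps a X N : R) :
  0 < eps -> eps <= 1 -> 0 <= a -> 0 <= alpha ->
  0 <= N -> N * (1 / 100 / 100 * (1 / 100 / 100)) <= 1 / 400 ->
  a <= eps / 100 / 100 -> alpha * a <= eps / 100 / 100 -> a * X <= eps / 100 / 100 ->
  (1 + eps / 8) * ((1 + eps / 8) * ((1 - eps) / (1 - a) ^+ 3)
    + (1 + (eps / 8)^-1) * (N / 8 * alpha ^+ 2 * a ^+ 2))
  + 2 * (4 * a * X) + 2 * (eps / 8) <= 1.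
Proof.
move=> e0 e1 a0 al0 N0 N1 aa aal aX.
have a1 : 0 < 1 - a by lra.
have inv3 : ((1 - a) ^+ 3)^-1 <= 1 + 6 * a.
  rewrite -[leLHS]mul1r ler_pdivrMr ?exprn_gt0//.
  have H1 : 0 <= a * (1 - 6 * a) by rewrite mulr_ge0//; lra.
  have H2 : 0 <= a ^+ 2 * (3 - a) by rewrite mulr_ge0 ?sqr_ge0//; lra.
  have H3 : 0 <= a * (a ^+ 2 * (3 - a)) by rewrite mulr_ge0.
  move: H1 H2 H3; clear; rewrite !exprS !expr0; lra.
have ee : eps * eps <= eps by rewrite ler_piMl// ltW.
pose u := (1 + eps / 8) * (1 + eps / 8).
have u1 : u <= 1 + 17 / 64 * eps by move: ee; rewrite /u; clear; lra.
have u0 : 0 <= u by rewrite /u mulr_ge0//; move: e0; clear; lra.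
have first_le : u * ((1 - eps) / (1 - a) ^+ 3) <= 1 - 7 / 10 * eps.
  apply: le_trans (_ : (1 + 17 / 64 * eps) * ((1 - eps) * (1 + eps / 100)) <= _).
    have ne : 0 <= 1 - eps by rewrite subr_ge0.
    apply: ler_pM => //; first by rewrite mulr_ge0 ?invr_ge0 ?exprn_ge0 ?(ltW a1).
    rewrite ler_wpM2l//; apply: le_trans inv3 _; move: aa (ltW e0); clear; lra.
  have H : 0 <= eps * eps * eps by rewrite !mulr_ge0// ltW.
  have H' : 0 <= eps * eps by rewrite !mulr_ge0// ltW.
  move: H H' (ltW e0); clear; lra.
have second_le : (1 + eps / 8) * (1 + (eps / 8)^-1) * (N / 8 * alpha ^+ 2 * a ^+ 2)
     <= eps / 100.
  have -> : (1 + eps / 8) * (1 + (eps / 8)^-1) * (N / 8 * alpha ^+ 2 * a ^+ 2) =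
     u * (N * ((alpha * a) * ((alpha * a) / eps))).
    by rewrite /u; field; rewrite gt_eqF.
  have t0 : 0 <= alpha * a by rewrite mulr_ge0.
  have t1 : alpha * a / eps <= 1 / 100 / 100.
    by rewrite ler_pdivrMr//; move: aal; clear; lra.
  have t2 : alpha * a * (alpha * a / eps) <= eps / 100 / 100 * (1 / 100 / 100).
    by apply: ler_pM => //; rewrite divr_ge0// ltW.
  have t3 : 0 <= alpha * a * (alpha * a / eps) by rewrite mulr_ge0// divr_ge0// ltW.
  have u2 : u <= 2 by move: u1 e1; clear; lra.
  apply: le_trans (_ : 2 * (N * (eps / 100 / 100 * (1 / 100 / 100))) <= _).
    by apply: ler_pM => //; [rewrite mulr_ge0|rewrite ler_wpM2l].
  have := ler_wpM2l (ltW e0) N1; move: (ltW e0); clear; lra.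
have -> : (1 + eps / 8) * ((1 + eps / 8) * ((1 - eps) / (1 - a) ^+ 3)
    + (1 + (eps / 8)^-1) * (N / 8 * alpha ^+ 2 * a ^+ 2)) =
  u * ((1 - eps) / (1 - a) ^+ 3) +
  (1 + eps / 8) * (1 + (eps / 8)^-1) * (N / 8 * alpha ^+ 2 * a ^+ 2).
  by rewrite /u; ring.
move: first_le second_le aX (ltW e0); clear; lra.
Qed.

(** With a = alpha / D, the lower bound on D says a exp(1536 alpha) <= eps / 10^4. As the
    exponential is at least 1 and at least alpha, the same bound holds for a and for alpha a. *)
Lemma large_degree_constants (R : realType) (alpha eps D : R) :
  1 <= alpha -> 0 < eps -> eps <= 1 ->
  alpha * (100 * 100 * expR (1536 * alpha)) / eps <= D ->
  [/\ 0 < D, alpha / D <= 1 / 12, 1 <= 2 * (eps / 8) * D &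
   (1 + eps / 8) * ((1 + eps / 8) * ((1 - eps) / (1 - alpha / D) ^+ 3)
    + (1 + (eps / 8)^-1) * (13824 * alpha ^+ 2 * (alpha / D) ^+ 2))
  + 2 * (4 * (alpha / D) * expR (1536 * alpha)) + 2 * (eps / 8) <= 1].
Proof.
move=> alpha_ge1 eps_gt0 eps_le1 D_large.
pose X := expR (1536 * alpha); pose a := alpha / D.
have al0 : 0 <= alpha by exact: le_trans alpha_ge1.
have X_ge : 1 + 1536 * alpha <= X by exact: expR_ge1Dx.
have X1 : 1 <= X.
  by apply: le_trans X_ge; rewrite lerDl; apply: mulr_ge0 al0; apply: ler0n.
have Xal : alpha <= X.
  apply: le_trans X_ge; rewrite -[leLHS]add0r; apply: lerD; first exact: ler01.
  by apply: ler_peMl al0 _; rewrite ler1n.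
have H : alpha * (100 * 100 * X) <= D * eps by rewrite -ler_pdivrMr.
have De : 100 * 100 <= D * eps.
  apply: le_trans H; move: alpha_ge1 X1; clear; nra.
have D0 : 0 < D.
  rewrite -(pmulr_lgt0 _ eps_gt0); apply: lt_le_trans De.
  by rewrite mulr_gt0.
have a0 : 0 <= a by rewrite divr_ge0// ltW.
have Da : D * a = alpha by rewrite /a; field; rewrite gt_eqF.
have aX : a * X <= eps / 100 / 100.
  have : alpha * (100 * 100 * X) / D <= eps by rewrite ler_pdivrMr// [leRHS]mulrC.
  have -> : alpha * (100 * 100 * X) / D = 100 * 100 * (a * X) by rewrite /a; ring.
  by clear; lra.
have aa : a <= eps / 100 / 100 by apply: le_trans aX; rewrite ler_peMr.
have aal : alpha * a <= eps / 100 / 100.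
  by apply: le_trans aX; rewrite mulrC ler_wpM2l.
have a12 : a <= 1 / 12 by move: aa eps_le1; clear; lra.
have N8 : 13824 = 8 * 13824 / 8 :> R by rewrite mulrAC divff ?mul1r// pnatr_eq0.
have N1 : 8 * 13824 * (1 / 100 / 100 * (1 / 100 / 100)) <= 1 / 400 :> R by clear; lra.
split; [exact: D0|exact: a12|by move: De; clear; lra|rewrite {1}N8].
have N0 : 0 <= 8 * 13824 :> R := mulr_ge0 (ler0n _ _) (ler0n _ _).
exact: (gap_constants eps_gt0 eps_le1 a0 al0 N0 N1 aa aal aX).
Qed.

(** * The star inequality under local spectral contraction *)

Section VertexGap.
Context {R : realType} {V : finType} (E : rel V) {q : nat} (A : 'M[R]_q)
  (lam : 'cV[R]_q) (alpha eps : R).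
Hypothesis E_sym : symmetric E.
Hypothesis E_irr : irreflexive E.
Hypothesis A_sym : forall s t, A s t = A t s.
Hypothesis A_ge0 : forall s t, 0 <= A s t.
Hypothesis A_le1 : forall s t, A s t <= 1.
Hypothesis lam_ge0 : forall s, 0 <= lam s 0.
Hypothesis E_triangle : forall x y z, E x y -> E y z -> ~~ E x z.
Hypothesis contraction : local_spectral_contraction alpha eps A lam E.

Local Notation D := ((max_degree E)%:R : R).
Local Notation mu := (gibbs A lam E).

Lemma contraction_center v sigma : good E A lam v sigma -> forall x,
  \sum_s (1 - A x s) * center_law E A lam v sigma s <= alpha / D.
Proof.
move=> gs x; have [c1 _ _] := contraction gs.
apply: le_trans c1; apply: le_trans (mx_entry_le_norm _ x 0).
rewrite mxE le_eqVlt; apply/orP; left; apply/eqP; apply: eq_bigr => s _.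
by rewrite /center_law; congr (_ * _); rewrite !mxE.
Qed.

Lemma contraction_leaf v sigma : good E A lam v sigma -> forall i, E v i -> forall s,
  \sum_y (1 - A s y) * leaf_law E A lam v i sigma y <= alpha / D.
Proof.
move=> gs i vi s; have [_ c2 _] := contraction gs.
have iv : i != v by apply: contraTneq vi => ->; rewrite E_irr.
pose i' : {u : V | u != v} := exist (fun u => u != v) i iv.
apply: le_trans (c2 i' vi); apply: le_trans (mx_entry_le_norm _ s 0).
rewrite mxE le_eqVlt; apply/orP; left; apply/eqP; apply: eq_bigr => y _.
rewrite (leaf_lawE E_sym E_irr A_sym A_ge0 lam_ge0 E_triangle gs (i := i'))//.
by rewrite !mxE.
Qed.

Lemma contraction_spectral v sigma : good E A lam v sigma -> forall g : 'I_q -> R,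
  \sum_x (\sum_(i | E v i) leaf_law E A lam v i sigma x) *
     (\sum_s (1 - A x s) * center_law E A lam v sigma s * g s) ^+ 2 <=
  (1 - eps) / D * \sum_s center_law E A lam v sigma s * g s ^+ 2.
Proof.
move=> gs g; have [_ _ c3] := contraction gs.
set M := (_ *m _ *m _) in c3.
have m0 s : 0 <= center_law E A lam v sigma s by exact: center_law_ge0.
(* Evaluate the operator at sqrt(m) g, with m the marginal of [v]: the square root of m inside [M]
   then restores the weight m. *)
pose x : 'cV[R]_q := \col_s (Num.sqrt (center_law E A lam v sigma s) * g s).
have xsE s : x s 0 = Num.sqrt (center_law E A lam v sigma s) * g s by rewrite mxE.
have xE : euclid_norm x ^+ 2 = \sum_s center_law E A lam v sigma s * g s ^+ 2.
  by rewrite sqr_euclid_norm; apply: eq_bigr => s _; rewrite mxE exprMn sqr_sqrtr.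
have MxE : euclid_norm (M *m x) ^+ 2 =
    \sum_x (\sum_(i | E v i) leaf_law E A lam v i sigma x) *
     (\sum_s (1 - A x s) * center_law E A lam v sigma s * g s) ^+ 2.
  rewrite sqr_euclid_norm; apply: eq_bigr => t _.
  rewrite /M -!mulmxA diag_sqrt_mul exprMn.
  have NE : (\sum_(i : {u : V | u != v} | E v (val i)) marginal_del A lam (pin E v sigma) i) t 0
      = \sum_(i | E v i) leaf_law E A lam v i sigma t.
    rewrite summxE (eq_bigr (fun i : {u : V | u != v} => leaf_law E A lam v (val i) sigma t)).
      rewrite -(big_sig _ (fun u => u != v) (E v) (fun i => leaf_law E A lam v i sigma t)).
      apply: eq_bigl => i; case vi : (E v i); rewrite ?andbF// andbT.
      by apply: contraTneq vi => ->; rewrite E_irr.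
    by move=> i vi; apply: leaf_lawE.
  have N0 : 0 <= \sum_(i | E v i) leaf_law E A lam v i sigma t.
    by apply: sumr_ge0 => i _; apply: leaf_law_ge0.
  rewrite NE sqr_sqrtr//; congr (_ * _ ^+ 2).
  rewrite mxE; apply: eq_bigr => s _; rewrite diag_sqrt_mul -!mulrA.
  congr (_ * _); first by rewrite !mxE.
  by rewrite xsE -/(center_law E A lam v sigma s) mulrA -expr2 sqr_sqrtr ?m0.
rewrite -MxE -xE; apply: le_trans (_ : (op_norm M * euclid_norm x) ^+ 2 <= _).
  by rewrite lerXn2r ?nnegrE ?euclid_norm_ge0 ?op_norm_le// (le_trans _ (op_norm_le M x))// euclid_norm_ge0.
by rewrite exprMn ler_wpM2r ?sqr_ge0.
Qed.

Hypothesis alpha_ge1 : 1 <= alpha.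
Hypothesis eps_gt0 : 0 < eps.
Hypothesis eps_le1 : eps <= 1.
Hypothesis D_large : alpha * (100 * 100 * expR (1536 * alpha)) / eps <= D.

(** [star_inequality] with gamma = delta = eps / 8 and F built from the level 0 part [h] of r = L_v
    f. *)
Lemma vertex_gap v f :
  eps / 8 * inner mu (fluct E A lam v f) (fluct E A lam v f) <=
  1 / 2 * inner mu (fluct E A lam v f) (fluct E A lam v f)
   + \sum_i inner mu (fluct E A lam v f) (star_fluct E A lam v i f)
   + \sum_i \sum_(j | j != i) inner mu (star_fluct E A lam v i f) (star_fluct E A lam v j f)
   + (2 * D)^-1 * \sum_i inner mu (star_fluct E A lam v i f) (star_fluct E A lam v i f).
Proof.
pose X := expR (1536 * alpha); pose a := alpha / D; pose delta := eps / 8.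
have [D0 a12 dD consts] := large_degree_constants alpha_ge1 eps_gt0 eps_le1 D_large.
have al0 : 0 <= alpha by exact: le_trans alpha_ge1.
have a0 : 0 <= a by rewrite divr_ge0// ltW.
have Da : D * a = alpha by rewrite /a; field; rewrite gt_eqF.
have d0 : 0 < delta by rewrite divr_gt0.
have cb sigma (gs : good E A lam v sigma) x := contraction_center gs x.
have lb sigma (gs : good E A lam v sigma) i (vi : E v i) s := contraction_leaf gs vi s.
have sp sigma (gs : good E A lam v sigma) g := contraction_spectral gs g.
set r := fluct E A lam v f.
pose h := component (star_fluct E A lam v) set0 r.
have h_inv : leaf_invariant E v h by apply: component0_invariant.
have h0 sigma : \sum_s center_law E A lam v sigma s * h (update sigma v s) = 0.
  by apply: component0_center_mean.
have hh0 : 0 <= inner mu h h by apply: inner_ge0 => *; apply: gibbs_ge0.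
have deg : #|nbhd E v|%:R <= D by rewrite ler_nat leq_bigmax.
have dega : #|nbhd E v|%:R * a <= alpha by rewrite -[leRHS]Da ler_wpM2r.
pose k1 := (1 + delta) * ((1 - eps) / (1 - a) ^+ 3) + (1 + delta^-1) * (13824 * alpha ^+ 2 * a ^+ 2).
have star := (@star_inequality _ _ (inner mu) (innerC mu) (innerDl mu) (innerZl mu)
  (fun g => inner_ge0 mu g (gibbs_ge0 E A_ge0 lam_ge0)) _ (star_fluct E A lam v)
  (star_fluct_idem A lam E_irr v) (star_fluct_sym E_sym E_irr A_sym A_ge0 lam_ge0 v)
  (star_fluctC A lam E_sym E_triangle v)
  D delta (eps / 8) k1 (4 * a * X) (test_function E A lam v h) f r).
apply: star.
- exact: D0.
- exact: d0.
- by move: eps_le1; lra.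
- exact: dD.
- exact: consts.
- rewrite /r [RHS](fluct_sym E_sym E_irr A_sym A_ge0 lam_ge0) (fluct_idem _ _ E_irr).
  exact: innerC.
- have -> : f - r = resample E A lam v f by rewrite /r fluctE opprB addrCA subrr addr0.
  exact: inner_test_resample.
(* F_0 and r_0 are compared on feasible pinnings; the others carry no mass. *)
- move=> y; apply: eq_bigr => sigma _; have [gs|ng] := boolP (good E A lam v sigma).
    by rewrite (component_test_set0 (a := a) E_sym E_irr A_sym A_ge0 lam_ge0 E_triangle A_le1).
  by rewrite (gibbs_good A_ge0 lam_ge0 ng) !mul0r.
- rewrite -/h.
  have := component_test_norm1 E_sym E_irr A_sym A_ge0 lam_ge0 E_triangle A_le1 a0 a12 cb lb h_inv
    d0 dega h0 sp.
  move/(ler_wpM2l (ltW D0)) => H; apply: le_trans H _; rewrite [leLHS]mulrA; apply: (ler_wpM2r hh0).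
  rewrite /k1 mulrDr le_eqVlt; apply/orP; left; apply/eqP; congr (_ + _).
    move: ((1 - a) ^+ 3)^-1 D0 => c D0; field; rewrite gt_eqF//.
  (* The factor D is absorbed by one factor a, as D a = alpha. *)
  have -> : alpha ^+ 2 = alpha * (D * a) by rewrite Da expr2.
  by move: (1 + delta^-1) (13824 : R) => u N; ring.
- exact: (component_test_norm_ge2 E_sym E_irr A_sym A_ge0 lam_ge0 E_triangle A_le1 a0 a12 cb lb h_inv dega).
Qed.

End VertexGap.

(** * The Glauber dynamics on the support *)

Section GlauberGap.
Context {R : realType} {V : finType} (E : rel V) {q : nat} (A : 'M[R]_q)
  (lam : 'cV[R]_q).
Hypothesis E_sym : symmetric E.
Hypothesis E_irr : irreflexive E.
Hypothesis A_sym : forall s t, A s t = A t s.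
Hypothesis A_ge0 : forall s t, 0 <= A s t.
Hypothesis lam_ge0 : forall s, 0 <= lam s 0.

Local Notation mu := (gibbs A lam E).
Local Notation S := (gibbs_support A lam E).
Local Notation muS := (fun x : S => mu (val x)).
Local Notation L := (fluct E A lam).

(** Otherwise detailed balance would give every move from [sigma] at [v] probability 0, while these
    probabilities sum to 1. *)
Lemma heat_positive v sigma : 0 < mu sigma -> heat E A lam v sigma (sigma v) != 0.
Proof.
move=> m0; have := sum_heat E A lam v sigma.
rewrite gt_eqF ?sum_local_weight_gt0//= => h1.
apply: contra_eq_neq h1 => h0; rewrite big1 ?(eq_sym 0) ?oner_eq0// => s _.
have := detailed_balance E_sym E_irr A_sym A_ge0 lam_ge0 v sigma s.
by rewrite h0 mulr0 => /eqP; rewrite mulf_eq0 gt_eqF// => /eqP.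
Qed.

(** The configurations agreeing with [sigma] off [v] are its updates at [v], with masses
    proportional to [heat] by detailed balance. *)
Lemma cprob_heat v sigma s : 0 < mu sigma ->
  cprob mu [pred z : config V q | z v == s]
    [pred z : config V q | [forall u, (u != v) ==> (z u == sigma u)]] =
  heat E A lam v sigma s.
Proof.
move=> m0; have h0 := heat_positive v m0.
have db t : mu (update sigma v t) = mu sigma * heat E A lam v sigma t / heat E A lam v sigma (sigma v).
  by rewrite detailed_balance// mulfK.
have agree (z : config V q) : [forall u, (u != v) ==> (z u == sigma u)] = (z == update sigma v (z v)).
  apply/forallP/eqP => [H|-> u]; last by rewrite ffunE; case: eqP => //=.
  apply/ffunP => u; rewrite ffunE; have := H u; case: eqP => [->//|_ /= /eqP//].
have Xs : prob mu [pred z : config V q | (z v == s) && [forall u, (u != v) ==> (z u == sigma u)]]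
    = mu (update sigma v s).
  rewrite /prob (big_pred1 (update sigma v s))// => z /=; rewrite agree.
  by apply/andP/eqP => [[/eqP <- /eqP//]|->]; rewrite update_same !eqxx.
have Ys : prob mu [pred z : config V q | [forall u, (u != v) ==> (z u == sigma u)]] =
    mu sigma / heat E A lam v sigma (sigma v).
  rewrite /prob (partition_big (fun z : config V q => z v) predT)//=.
  transitivity (\sum_t mu (update sigma v t)).
    apply: eq_bigr => t _; rewrite (big_pred1 (update sigma v t))// => z /=; rewrite agree.
    by apply/andP/eqP => [[/eqP zE /eqP <-]|->]; rewrite ?update_same ?eqxx.
  under eq_bigr do rewrite db.
  by rewrite -mulr_suml -mulr_sumr sum_heat gt_eqF ?sum_local_weight_gt0// mulr1.
rewrite /cprob Xs Ys db; field; rewrite h0 gt_eqF//.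
Qed.

(** The value 0 is harmless: configurations off the support have mass 0 and are never reached from
    the support by heat-bath moves. *)
Definition extend (f : S -> R) (sigma : config V q) : R := oapp f 0 (insub sigma).

Lemma extend_val f x : extend f (val x) = f x.
Proof. by rewrite /extend valK. Qed.

Lemma inner_support (f g : S -> R) (F G : config V q -> R) :
  (forall x, F (val x) = f x) -> (forall x, G (val x) = g x) ->
  inner muS f g = inner mu F G.
Proof.
move=> Ff Gg; rewrite /inner [RHS](bigID (fun sigma => 0 < mu sigma)) /=.
rewrite [X in _ = _ + X]big1 ?addr0 => [|sigma]; last first.
  rewrite -leNgt => m0.
  have -> : mu sigma = 0 by apply/eqP; rewrite eq_le m0 gibbs_ge0.
  by rewrite !mul0r.
rewrite (eq_bigl (fun sigma => (0 < mu sigma) && true)) => [|sigma]; last by rewrite andbT.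
by rewrite (big_sig _ (fun sigma => 0 < mu sigma) xpredT); apply: eq_bigr => x _; rewrite Ff Gg.
Qed.

Lemma transition_resample (f : S -> R) x :
  transition_op (glauber A lam E) f x =
  (#|V|%:R)^-1 * \sum_v resample E A lam v (extend f) (val x).
Proof.
rewrite /transition_op /glauber.
under eq_bigr do rewrite -mulrA mulr_suml.
rewrite -mulr_sumr exchange_big /=; congr (_ * _); apply: eq_bigr => v _.
under eq_bigr do rewrite mulr_suml big_mkcond /=.
rewrite exchange_big; apply: eq_bigr => s _ /=.
rewrite -big_mkcond /=; under eq_bigr do rewrite (cprob_heat v s (valP x)).
rewrite -mulr_sumr; congr (_ * _); rewrite /extend.
case: insubP => [y my <-|ny] /=; first by rewrite (big_pred1 y)// => z; rewrite /= eq_sym (inj_eq val_inj).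
by rewrite big1// => y /eqP yE; move: ny; rewrite yE (valP y).
Qed.

Lemma glauber_ge0 x y : 0 <= glauber A lam E x y.
Proof.
rewrite mulr_ge0 ?invr_ge0 ?ler0n// sumr_ge0// => v _; rewrite sumr_ge0// => s _.
by rewrite (cprob_heat v s (valP x)) heat_ge0.
Qed.

Hypothesis V_gt0 : (0 < #|V|)%N.

Let n_neq0 : #|V|%:R != 0 :> R.
Proof. by rewrite pnatr_eq0 -lt0n. Qed.

Lemma sum_glauber x : \sum_y glauber A lam E x y = 1.
Proof.
have -> : \sum_y glauber A lam E x y = transition_op (glauber A lam E) (fun=> 1) x.
  by apply: eq_bigr => y _; rewrite mulr1.
rewrite transition_resample (eq_bigr (fun=> 1)) => [|v _].
  by rewrite sumr_const mulVf.
have m0 := valP x; rewrite /resample.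
transitivity (\sum_s heat E A lam v (val x) s).
  apply: eq_bigr => s _; rewrite /extend; case: insubP => [y _ _|]; first by rewrite mulr1.
  rewrite -leNgt => ms.
  have ms0 : mu (update (val x) v s) = 0 by apply/eqP; rewrite eq_le ms gibbs_ge0.
  have := detailed_balance E_sym E_irr A_sym A_ge0 lam_ge0 v (val x) s.
  by rewrite ms0 mul0r => /eqP; rewrite mulf_eq0 gt_eqF//= => /eqP ->; rewrite mul0r.
by rewrite sum_heat gt_eqF ?sum_local_weight_gt0.
Qed.

Lemma laplacian_fluct (f : S -> R) x :
  ((#|V|%:R)^-1 *: \sum_v L v (extend f)) (val x) =
  (f - transition_op (glauber A lam E) f) x.
Proof.
transitivity ((#|V|%:R)^-1 * (\sum_v L v (extend f)) (val x)) => //.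
transitivity (f x - transition_op (glauber A lam E) f x) => //.
rewrite fct_sumE transition_resample.
have -> : \sum_v L v (extend f) (val x) =
    \sum_v (f x - resample E A lam v (extend f) (val x)).
  by apply: eq_bigr => v _; rewrite -[in RHS](extend_val f).
rewrite sumrB sumr_const mulrBr; congr (_ - _).
by rewrite -[X in _ * X]mulr_natr mulrCA mulVf// mulr1.
Qed.

Lemma glauber_sym (f g : S -> R) :
  inner muS f (transition_op (glauber A lam E) g) =
  inner muS (transition_op (glauber A lam E) f) g.
Proof.
have key (h k : S -> R) : inner muS h (transition_op (glauber A lam E) k) =
    (#|V|%:R)^-1 * \sum_v inner mu (extend h) (resample E A lam v (extend k)).
  rewrite (inner_support (F := extend h)
    (G := (#|V|%:R)^-1 *: \sum_v resample E A lam v (extend k))).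
  - by rewrite (bilZr _ (innerC mu) (innerZl mu)) (bil_sumr _ (innerC mu) (innerDl mu) (innerZl mu)).
  - exact: extend_val.
  - move=> x; rewrite transition_resample.
    transitivity ((#|V|%:R)^-1 * (\sum_v resample E A lam v (extend k)) (val x)) => //.
    by rewrite fct_sumE.
rewrite key innerC key; congr (_ * _); apply: eq_bigr => v _.
by rewrite -resample_sym// innerC.
Qed.

Lemma dirichlet_form (f : S -> R) :
  inner muS f (f - transition_op (glauber A lam E) f) =
  (#|V|%:R)^-1 * \sum_v inner mu (L v (extend f)) (L v (extend f)).
Proof.
rewrite (inner_support (extend_val f) (laplacian_fluct f)).
rewrite (bilZr _ (innerC mu) (innerZl mu)) (bil_sumr _ (innerC mu) (innerDl mu) (innerZl mu)).
by congr (_ * _); apply: eq_bigr => v _; rewrite [RHS]fluct_sym// fluct_idem.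
Qed.

(** Id - P is 1/n times the sum of the L_v, so the inequality for that sum becomes the Bochner
    inequality for P with constant gamma / n. *)
Lemma glauber_gap (gamma : R) : 0 < gamma ->
  irreducible_chain (glauber A lam E) ->
  (forall f, gamma * \sum_v inner mu (L v f) (L v f) <=
     inner mu (\sum_v L v f) (\sum_v L v f)) ->
  spectral_gap_ge muS (glauber A lam E) (gamma / #|V|%:R).
Proof.
move=> g0 irr bochner.
have n0 : 0 < #|V|%:R :> R by rewrite ltr0n.
apply: spectral_gap_of_bochner.
- by move=> x; apply: (valP x).
- exact: glauber_ge0.
- exact: sum_glauber.
- exact: irr.
- exact: glauber_sym.
- by rewrite divr_gt0.
- move=> f; rewrite dirichlet_form mulr_ge0 ?invr_ge0 ?ler0n// sumr_ge0// => v _.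
  by apply: inner_ge0 => *; apply: gibbs_ge0.
- move=> f; rewrite dirichlet_form.
  rewrite (inner_support (laplacian_fluct f) (laplacian_fluct f)).
  rewrite innerZl.
  rewrite (bilZr _ (innerC mu) (innerZl mu)).
  have := bochner (extend f); set S1 := \sum_v inner _ _ _; set S2 := inner mu _ _ => H.
  have -> : gamma / #|V|%:R * ((#|V|%:R)^-1 * S1) = (#|V|%:R)^-1 * ((#|V|%:R)^-1 * (gamma * S1)) by ring.
  by rewrite !ler_wpM2l ?invr_ge0 ?ler0n.
Qed.

End GlauberGap.

Theorem theorem5 (R : realType) (alpha eps : R) (halpha : 1 <= alpha)
    (heps : 0 < eps <= 1) :
  exists Delta0 c : R,
    [/\ 2 * alpha <= Delta0, 0 < c &
      forall (V : finType) (E : rel V) (q : nat) (A : 'M[R]_q)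
             (lam : 'cV[R]_q),
        simple_graph E ->
        Delta0 <= (max_degree E)%:R ->
        (5%:R%:E <= girth R E)%E ->
        (2 <= q)%N ->
        (forall s t : 'I_q, 0 <= A s t <= 1) ->
        A^T = A ->
        (forall s : 'I_q, 0 <= lam s 0) ->
        (exists sigma : config V q, 0 < weight A lam E sigma) ->
        local_spectral_contraction alpha eps A lam E ->
        irreducible_chain (glauber A lam E) ->
        spectral_gap_ge (fun x : gibbs_support A lam E => gibbs A lam E (val x))
          (glauber A lam E) (c / #|V|%:R)].
Proof.
have [eps0 eps1] := andP heps.
have X1 : 1 <= expR (1536 * alpha).
  rewrite -[leLHS]expR0 ler_expR; apply: mulr_ge0; [exact: ler0n|exact: le_trans halpha].
(* [Delta0] is the threshold of [large_degree_constants]; it is at least 2 alpha as eps <= 1 and the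
   exponential is at least 1. The gap constant is the eps / 8 of [vertex_gap]. *)
exists (alpha * (100 * 100 * expR (1536 * alpha)) / eps), (eps / 8); split.
- rewrite ler_pdivlMr//.
  apply: le_trans (_ : 2 * alpha * 1 <= _).
    by apply: ler_wpM2l => //; rewrite mulr_ge0// (le_trans _ halpha).
  by move: (expR _) X1 => X X1; nra.
- by rewrite divr_gt0.
move=> V E q A lam [Es Ei] D_large girth5 _ A01 AT lam0 _ contraction irr.
have As s t : A s t = A t s by rewrite -{1}AT mxE.
have A0 s t : 0 <= A s t by case/andP: (A01 s t).
have A1 s t : A s t <= 1 by case/andP: (A01 s t).
have tri := girth_triangle (conj Es Ei) girth5.
have sq := girth_square (conj Es Ei) girth5.
have [D0 _ _ _] := large_degree_constants halpha eps0 eps1 D_large.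
(* A graph without vertices has maximum degree 0, which the lower bound on the degree excludes. *)
have V0 : (0 < #|V|)%N.
  rewrite lt0n; apply/negP => /eqP V0; move: D0; rewrite ltr0n /max_degree big1 ?ltnn// => v _.
  by have := fintype0 v V0.
apply: glauber_gap => //; first by rewrite divr_gt0.
move=> f; rewrite mulr_sumr.
apply: le_trans (star_sum Es Ei As A0 lam0 tri sq f D0 _); last first.
  by move=> v; rewrite ler_nat leq_bigmax.
by apply: ler_sum => v _; apply: (vertex_gap Es Ei As A0 A1 lam0 tri contraction).
Qed.
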